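(* Let $(\mathcal A,\sigma)\to\Delta$ be a smooth family of algebras with involution and let $\mathcal J\colon\Delta\to\mathcal{H}\mathrm{erm}(n;\mathcal A,\sigma)$ be a smooth nondegenerate section. Then $\mathcal U(\mathcal J;\mathcal A)$ is a smooth subfamily of $\mathcal{GL}(n;\mathcal A)$. If the algebras are commutative, the special unitary groups $\mathcal{SU}(\mathcal J;\mathcal A)$ form a subfamily of $\mathcal U(\mathcal J;\mathcal A)$.
   Context: A smooth family of algebras over a smooth manifold $\Delta$ is a (finite rank) real vector bundle $\mathcal A\to\Delta$ with a smooth fiberwise-bilinear multiplication and smooth unit section making each fiber $\mathcal A_\delta$ a finite-dimensional associative unital real algebra. An involution $\sigma\colon\mathcal A\to\mathcal A$ is a smooth map over $\Delta$ with $\sigma^2=\mathrm{id}$ restricting on each fiber to a unital $\mathbb R$-linear map with $\sigma(ab)=\sigma(b)\sigma(a)$ (an algebra automorphism when the algebra is commutative; $\sigma=\mathrm{id}$ is allowed in that case). For a matrix $X$ over $\mathcal A_\delta$ let $X^\dagger=\sigma(X)^T$ ($\sigma$ applied entrywise). $\mathcal H\mathrm{erm}(n;\mathcal A,\sigma)=\bigcup_\delta\{X\in\mathrm M(n;\mathcal A_\delta):X^\dagger=X\}$, which is a smooth family over $\Delta$. A section $\mathcal J$ is nondegenerate if $\mathcal J_\delta$ is invertible for all $\delta$. $\mathcal{GL}(n;\mathcal A)=\bigcup_\delta\mathrm{GL}(n;\mathcal A_\delta)\to\Delta$; $\mathcal U(\mathcal J;\mathcal A)=\bigcup_\delta\{X\in\mathrm{GL}(n;\mathcal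 A_\delta):X^\dagger\mathcal J_\delta X=\mathcal J_\delta\}$; and, for commutative algebras, $\mathcal{SU}(\mathcal J;\mathcal A)$ is the subset of elements of determinant $1$. A smooth family over $\Delta$ is a smooth manifold with a smooth submersion to $\Delta$; a subfamily is a closed submanifold on which the projection is still a submersion. *)

(* Defs.v *)
From HB Require Import structures.
From mathcomp Require Import all_boot all_order all_algebra.
From mathcomp Require Import all_classical all_reals all_analysis.

Set Implicit Arguments.
Unset Strict Implicit.
Unset Printing Implicit Defensive.

Import Order.TTheory GRing.Theory Num.Theory.
Import numFieldNormedType.Exports.

Local Open Scope classical_set_scope.
Local Open Scope ring_scope.

(* Associative unital R-algebras. The library's algType excludes the zero     *)
(* ring, which occurs as the fiber of a rank 0 bundle of algebras. The        *)
(* R-module structure lives on the alias alg_module, because the join of      *)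
(* pzRingType and lmodType cannot be declared on top of the library.          *)
HB.mixin Record PzRing_isPzAlgebra (R : pzRingType) A of GRing.PzRing A := {
  ascale : R -> A -> A ;
  ascaleA : forall (k l : R) (a : A), ascale k (ascale l a) = ascale (k * l) a ;
  ascale1 : forall a : A, ascale 1 a = a ;
  ascaleDr : forall (k : R) (a b : A), ascale k (a + b) = ascale k a + ascale k b ;
  ascaleDl : forall (a : A) (k l : R), ascale (k + l) a = ascale k a + ascale l a ;
  ascaleAl : forall (k : R) (a b : A), ascale k (a * b) = ascale k a * b ;
  ascaleAr : forall (k : R) (a b : A), ascale k (a * b) = a * ascale k b
}.

#[short(type="pzAlgType")]
HB.structure Definition PzAlgebra (R : pzRingType) :=
  {A of GRing.PzRing A & PzRing_isPzAlgebra R A}.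

Definition alg_module (R : pzRingType) (A : pzAlgType R) : Type := A.

HB.instance Definition _ (R : pzRingType) (A : pzAlgType R) :=
  GRing.Zmodule.on (@alg_module R A).
HB.instance Definition _ (R : pzRingType) (A : pzAlgType R) :=
  GRing.Zmodule_isLmodule.Build R (@alg_module R A)
    (@ascaleA R A) (@ascale1 R A) (@ascaleDr R A) (@ascaleDl R A).

Section SmoothFamilies.
Variable R : realType.

(* C^k and C^oo maps on a set V, which is open wherever this is used. *)
Fixpoint Ck_on (k : nat) (m p : nat) (V : set 'rV[R]_m)
    (f : 'rV[R]_m -> 'rV[R]_p) : Prop :=
  match k with
  | 0 => forall y, V y -> {for y, continuous f}
  | k'.+1 => (forall y, V y -> differentiable f y) /\
             (forall v, Ck_on k' V (fun y => 'D_v f y))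
  end.

Definition smooth_on (m p : nat) (V : set 'rV[R]_m)
    (f : 'rV[R]_m -> 'rV[R]_p) : Prop := forall k, Ck_on k V f.

(* cinv matters only on the image cmap @` cdom. Charts carry their own        *)
(* dimension, so that a manifold may have components of various dimensions.   *)
Record chart (T : Type) := Chart {
  cdim : nat ;
  cdom : set T ;
  cmap : T -> 'rV[R]_cdim ;
  cinv : 'rV[R]_cdim -> T }.

Arguments cmap {T} c x.
Arguments cinv {T} c y.

Definition is_chart T (c : chart T) : Prop :=
  open (cmap c @` cdom c) /\
  (forall x, cdom c x -> cinv c (cmap c x) = x).

(* An atlas is a set of charts on an ambient type T. The manifold itself is   *)
(* the part of T covered by the charts, so open submanifolds and submanifolds *)
(* of a manifold are atlases on the same ambient type.                        *)
Definition atlas (T : Type) := set (chart T).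

Definition carrier T (A : atlas T) : set T := \bigcup_(c in A) cdom c.

Definition smooth_between T T' (f : T -> T') (c : chart T) (c' : chart T') :=
  let V := cmap c @` (cdom c `&` f @^-1` cdom c') in
  open V /\ smooth_on V (cmap c' \o f \o cinv c).

Definition compatible T (c c' : chart T) : Prop :=
  smooth_between id c c' /\ smooth_between id c' c.

Definition smooth_atlas T (A : atlas T) : Prop :=
  (forall c, A c -> is_chart c) /\
  (forall c c', A c -> A c' -> compatible c c').

Definition max_atlas T (A : atlas T) : atlas T :=
  [set c | [/\ is_chart c, cdom c `<=` carrier A &
               forall c', A c' -> compatible c c']].

(* The open sets of the topology induced by an atlas. *)
Definition mopen T (A : atlas T) (U : set T) : Prop :=
  U `<=` carrier A /\ (forall c, A c -> open (cmap c @` (cdom c `&` U))).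

Definition mclosed T (A : atlas T) (S : set T) : Prop :=
  S `<=` carrier A /\ mopen A (carrier A `\` S).

Definition mhausdorff T (A : atlas T) : Prop :=
  forall x y, carrier A x -> carrier A y -> x <> y ->
  exists U V, [/\ mopen A U, mopen A V, U x, V y & U `&` V = set0].

Definition msecond_countable T (A : atlas T) : Prop :=
  exists B : set (set T),
  [/\ countable B,
      forall U, B U -> mopen A U &
      forall U x, mopen A U -> U x -> exists V, [/\ B V, V x & V `<=` U]].

Definition is_manifold T (A : atlas T) : Prop :=
  [/\ smooth_atlas A, mhausdorff A & msecond_countable A].

Definition smooth_map T T' (A : atlas T) (A' : atlas T') (f : T -> T') :=
  (forall x, carrier A x -> carrier A' (f x)) /\
  (forall c c', A c -> A' c' -> smooth_between f c c').

Definition submersion T T' (A : atlas T) (A' : atlas T') (f : T -> T') :=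
  smooth_map A A' f /\
  (forall c c' x, A c -> A' c' -> cdom c x -> cdom c' (f x) ->
     range ('d (cmap c' \o f \o cinv c) (cmap c x)) = setT).

Definition open_submanifold T (A : atlas T) (W : set T) : atlas T :=
  [set Chart (cdom c `&` W) (cmap c) (cinv c) | c in A].

(* The atlas induced on S by the slice charts of A: those in which S is       *)
(* { (y, z) in R^k x R^l | z = 0 }.                                           *)
Definition sub_atlas T (A : atlas T) (S : set T) : atlas T :=
  [set c' | exists (k l : nat) (U : set T) (f : T -> 'rV[R]_(k + l))
                   (g : 'rV[R]_(k + l) -> T),
    [/\ max_atlas A (Chart U f g),
        forall x, U x -> (S x <-> rsubmx (f x) = 0) &
        c' = Chart (U `&` S) (fun x => lsubmx (f x))
                   (fun y => g (row_mx y 0))]].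

Definition is_submanifold T (A : atlas T) (S : set T) : Prop :=
  S `<=` carrier A /\ S `<=` carrier (sub_atlas A S).

Definition is_subfamily T D (A : atlas T) (B : atlas D) (pi : T -> D)
    (S : set T) : Prop :=
  [/\ mclosed A S, is_submanifold A S & submersion (sub_atlas A S) B pi].

Section Bundles.
Variable D : Type.

Definition tot (E : D -> Type) := {x : D & E x}.

Definition tot_proj (E : D -> Type) (p : tot E) : D := projT1 p.

(* Local trivializations of rank trank; tinv x is the inverse of tmap x when  *)
(* tdom x holds.                                                              *)
Record triv (E : D -> Type) := Triv {
  trank : nat ;
  tdom : set D ;
  tmap : forall x, E x -> 'rV[R]_trank ;
  tinv : forall x, 'rV[R]_trank -> E x }.

Arguments tmap {E} t {x} e.
Arguments tinv {E} t x v.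

Definition tot_chart E (c : chart D) (t : triv E) : chart (tot E) :=
  @Chart (tot E) (cdim c + trank t)
    [set p | cdom c (projT1 p) /\ tdom t (projT1 p)]
    (fun p => row_mx (cmap c (projT1 p)) (tmap t (projT2 p)))
    (fun v => let x := cinv c (lsubmx v) in
              existT E x (tinv t x (rsubmx v))).

Definition tot_atlas E (B : atlas D) (T : set (triv E)) : atlas (tot E) :=
  [set tot_chart c t | c in B & t in T].

Definition is_triv (E : D -> lmodType R) (B : atlas D) (t : triv E) : Prop :=
  mopen B (tdom t) /\
  (forall x, tdom t x ->
     [/\ linear (@tmap E t x : E x -> 'rV[R]_(trank t)),
         cancel (@tmap E t x) (tinv t x) & cancel (tinv t x) (@tmap E t x)]).

(* Smoothness of the transition functions is the compatibility of the charts  *)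
(* that the trivializations induce on the total space.                        *)
Definition is_vector_bundle (E : D -> lmodType R) (B : atlas D)
    (T : set (triv E)) : Prop :=
  [/\ forall t, T t -> is_triv B t,
      carrier B `<=` \bigcup_(t in T) tdom t &
      smooth_atlas (tot_atlas B T)].

(* Trivializations of the Whitney sum E (+) E, whose total space is the fiber *)
(* product of the total space of E with itself over D.                        *)
Definition pair_triv E (t : triv E) : triv (fun x => E x * E x)%type :=
  @Triv (fun x => E x * E x)%type (trank t + trank t) (tdom t)
    (fun x e => row_mx (tmap t e.1) (tmap t e.2))
    (fun x v => (tinv t x (lsubmx v), tinv t x (rsubmx v))).

(* Trivializations of the bundle of n x n matrices over E, entry by entry. *)
Definition mx_triv n E (t : triv E) : triv (fun x => 'M[E x]_n) :=
  @Triv (fun x => 'M[E x]_n) (n * n * trank t) (tdom t)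
    (fun x X => mxvec (\matrix_(k < n * n) tmap t (mxvec X 0 k)))
    (fun x v => vec_mx (\row_(k < n * n) tinv t x (row k (vec_mx v)))).

Section AlgebraFamilies.
Variables (B : atlas D) (A : D -> pzAlgType R) (T : set (triv A)).

Record is_algebra_family : Prop := {
  base_manifold : is_manifold B ;
  base_carrier : carrier B = setT ;
  algebra_bundle : @is_vector_bundle (fun x => alg_module (A x)) B T ;
  smooth_mul :
    smooth_map (tot_atlas B (@pair_triv A @` T)) (tot_atlas B T)
      (fun p : tot (fun x => A x * A x)%type =>
         existT A (projT1 p) ((projT2 p).1 * (projT2 p).2)) ;
  smooth_one : smooth_map B (tot_atlas B T) (fun x => existT A x 1) }.

Record is_involution (sigma : forall x, A x -> A x) : Prop := {
  smooth_invol :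
    smooth_map (tot_atlas B T) (tot_atlas B T)
      (fun p : tot A => existT A (projT1 p) (sigma _ (projT2 p))) ;
  involK : forall x, involutive (sigma x) ;
  invol_linear : forall x,
    linear (sigma x : alg_module (A x) -> alg_module (A x)) ;
  invol1 : forall x, sigma x 1 = 1 ;
  involM : forall x (a b : A x), sigma x (a * b) = sigma x b * sigma x a }.

Definition mxfam n (x : D) : Type := 'M[A x]_n.

Definition mx_atlas n : atlas (tot (mxfam n)) :=
  tot_atlas B (@mx_triv n A @` T).
Arguments mx_atlas : clear implicits.

Definition mx_invertible n x (X : 'M[A x]_n) : Prop :=
  exists Y : 'M[A x]_n, X *m Y = 1%:M /\ Y *m X = 1%:M.

Definition GL n : set (tot (mxfam n)) :=
  [set p | mx_invertible (projT2 p : 'M[A (projT1 p)]_n)].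
Arguments GL : clear implicits.

Definition GL_atlas n : atlas (tot (mxfam n)) :=
  open_submanifold (mx_atlas n) (GL n).
Arguments GL_atlas : clear implicits.

Variable sigma : forall x, A x -> A x.

Definition adjoint n x (X : 'M[A x]_n) : 'M[A x]_n :=
  (map_mx (@sigma x) X)^T.

Definition Herm n : set (tot (mxfam n)) :=
  [set p | adjoint (projT2 p : 'M[A (projT1 p)]_n) = projT2 p].
Arguments Herm : clear implicits.

Definition Herm_atlas n : atlas (tot (mxfam n)) :=
  sub_atlas (mx_atlas n) (Herm n).
Arguments Herm_atlas : clear implicits.

Definition unitary_group n (J : forall x, 'M[A x]_n) : set (tot (mxfam n)) :=
  [set p | let X : 'M[A (projT1 p)]_n := projT2 p in
     GL n p /\ adjoint X *m J (projT1 p) *m X = J (projT1 p)].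

Definition U_atlas n (J : forall x, 'M[A x]_n) : atlas (tot (mxfam n)) :=
  sub_atlas (GL_atlas n) (unitary_group J).

(* Used for commutative fibers only. *)
Definition special_unitary_group n (J : forall x, 'M[A x]_n) :
    set (tot (mxfam n)) :=
  [set p | unitary_group J p /\ \det (projT2 p : 'M[A (projT1 p)]_n) = 1].

End AlgebraFamilies.
End Bundles.
End SmoothFamilies.

Arguments triv R {D} E.

Arguments tot_proj {D} E p.
Arguments mxfam {R D} A n x.
Arguments mx_atlas {R D} B {A} T n.
Arguments GL {R D} A n.
Arguments GL_atlas {R D} B {A} T n.
Arguments Herm {R D A} sigma n.
Arguments Herm_atlas {R D} B {A} T sigma n.
Arguments unitary_group {R D A} sigma {n} J.
Arguments special_unitary_group {R D A} sigma {n} J.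
Arguments U_atlas {R D} B {A} T sigma {n} J.
Arguments is_algebra_family {R D} B {A} T.
Arguments is_involution {R D} B {A} T sigma.

(* Main.v *)
Require Import Defs.
From HB Require Import structures.
From mathcomp Require Import all_boot all_order all_algebra.
From mathcomp Require Import all_classical all_reals all_analysis.
From mathcomp Require Import ring lra.
Import Order.TTheory GRing.Theory Num.Theory.
Import numFieldNormedType.Exports.
Local Open Scope classical_set_scope.
Local Open Scope ring_scope.

Set Implicit Arguments.
Unset Strict Implicit.
Unset Printing Implicit Defensive.

(** Both statements are instances of the regular value theorem in families.

    Near a point (x, X) of U(J) the group is the zero set of the defect
    X^dagger J X - J.  The defect is Hermitian, hence lies in a subbundle that
    varies with the base point; projecting it to the Hermitian part of the
    fiber at x loses nothing nearby ([involutive_equation]) and leaves an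
    equation F = 0 with values in a fixed vector space.  Already along the
    fiber its differential is onto: since X^dagger J X = J, moving X in the
    direction X J^-1 H / 2 changes the defect by H to first order
    ([unitary_defect_onto]).

    If the fibers are commutative, d = det X satisfies sigma(d) d = 1 on U(J).
    Near a point of SU(J) the equation d = sigma(d) then forces d = 1, because
    d^2 = 1 and d + 1 is invertible ([det_defect0]).  The defect d - sigma(d) takes
    values in the skew elements, again a subbundle cut out by an involution.
    It is a submersion along the fibers of U(J): for a skew element a, the
    Cayley transforms r of s a satisfy sigma(r) r = 1, so the curve X r stays
    in U(J), and det (X r) = r^n moves the defect in every skew direction as a
    varies.

    The criterion used twice ([regular_subfamily]) asks for a local equation
    F whose differential is onto on vertical vectors.  Base coordinates, F and
    some complementary linear coordinates then form a diffeomorphism, by the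
    inverse function theorem ([inverse_function], proved by contraction); it is
    a slice chart in which the projection is a coordinate projection, and a
    local section of the projection through the given point shows that the
    projection is a submersion in every other chart as well.

    Smoothness is handled pointwise: [smooth_at] says that a map between
    coordinate spaces is smooth near a point, [smooth_into] that a map from a
    coordinate space to a manifold is.  Openness of domains and smoothness of
    maps between charts become closure properties of these two notions. *)

(** * Smooth maps between coordinate spaces *)

Lemma near_open (T : topologicalType) (y : T) (P : T -> Prop) :
  (\forall z \near y, P z) -> exists V, [/\ open V, V y & forall z, V z -> P z].
Proof. by rewrite /prop_near1 nbhsE => -[V [oV Vy] VP]; exists V. Qed.

Lemma open_near (T : topologicalType) (V : set T) (y : T) : open V -> V y ->
  \forall z \near y, V z.
Proof. by move=> oV Vy; exact: open_nbhs_nbhs. Qed.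

Section Differentials.
Variables (R : realType) (V W : normedModType R).

(** Differentiability with explicit bounds: this form and its converse below
    avoid computing with little-o terms. *)
Lemma diff_estimate (f : V -> W) (x : V) : differentiable f x ->
  forall e, 0 < e ->
  \forall y \near x, `|f y - f x - 'd f x (y - x)| <= e * `|y - x|.
Proof.
move=> df e e0.
have := diff_locally df => /eqaddoP /(_ e e0).
rewrite [X in _ -> X](near_shift 0) subr0 => H.
apply: filterS H => y /=; rewrite addrK.
by rewrite -[(_ - _) y]/(f (y + x) - (f x + 'd f x y)) opprD addrA.
Qed.

Lemma estimate_diff (f : V -> W) (L : {linear V -> W}) (x : V) :
  continuous L ->
  (forall e, 0 < e ->
    \forall y \near x, `|f y - f x - L (y - x)| <= e * `|y - x|) ->
  differentiable f x /\ 'd f x = L :> (V -> W).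
Proof.
move=> cL H.
have dE : f \o shift x = cst (f x) + L +o_ 0 id.
  apply/eqaddoP => e e0.
  have := H e e0; rewrite [X in X -> _](near_shift 0) subr0.
  apply: filterS => y /=; rewrite addrK.
  by rewrite -[(_ - _) y]/(f (y + x) - (f x + L y)) opprD addrA.
have dfE := diff_unique cL dE.
split=> //; apply/diff_locallyP; split; first by rewrite dfE.
by rewrite dfE.
Qed.

Lemma near_eq_differentiable (f g : V -> W) (x : V) :
  (\forall y \near x, f y = g y) -> differentiable f x -> differentiable g x.
Proof.
move=> fg df; have fgx := nbhs_singleton fg.
suff [] : differentiable g x /\ 'd g x = 'd f x :> (V -> W) by [].
apply: estimate_diff; first exact: diff_continuous.
move=> e e0; have := diff_estimate df e0.
apply: filterS2 fg => y <-.
by rewrite -fgx.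
Qed.

End Differentials.

Section LinearMaps.
Variables (R : realType) (m : nat).

Lemma linear_rV_continuous (W : normedModType R) (L : {linear 'rV[R]_m -> W}) :
  continuous L.
Proof.
have -> : (L : _ -> _) = \sum_(i < m) (fun v : 'rV[R]_m => v 0 i *: L (delta_mx 0 i)).
  apply/funext => v; rewrite {1}(row_sum_delta v) linear_sum fct_sumE.
  by apply: eq_bigr => i _; rewrite linearZ.
move=> v; apply: differentiable_continuous; apply: differentiable_sum => i.
apply: differentiableZl; exact: differentiable_coord.
Qed.

End LinearMaps.

Section ContinuouslyDifferentiable.
Variables (R : realType) (m : nat).
Implicit Types (V : set 'rV[R]_m) (k : nat).

(** [Ck_on] with values in any normed module, so that real-valued functions, in
    particular coordinates, are covered as well. *)
Fixpoint Ck (W : normedModType R) k V (f : 'rV[R]_m -> W) : Prop :=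
  match k with
  | 0 => forall y, V y -> {for y, continuous f}
  | k'.+1 => (forall y, V y -> differentiable f y) /\
             (forall v, Ck k' V (fun y => 'D_v f y))
  end.

Lemma Ck_onE k p V (f : 'rV[R]_m -> 'rV[R]_p) : Ck_on k V f <-> Ck k V f.
Proof.
elim: k f => [|k IH] f; first exact: iff_refl.
by split=> -[df Df]; split=> // v; exact/IH/Df.
Qed.

(** The clauses of [Ck] only speak of germs at the points of V. *)
Lemma Ck_local (W : normedModType R) k V (f : 'rV[R]_m -> W) :
  (forall y, V y -> exists2 V', V' y & Ck k V' f) -> Ck k V f.
Proof.
elim: k f => [|k IH] f H /=; first by move=> y /H[V' V'y Hf]; exact: (Hf y V'y).
split; first by move=> y /H[V' V'y [df _]]; exact: df.
by move=> v; apply: IH => y /H[V' V'y [_ Df]]; exists V' => //; exact: Df.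
Qed.

Lemma Ck_sub (W : normedModType R) k V V' (f : 'rV[R]_m -> W) :
  V' `<=` V -> Ck k V f -> Ck k V' f.
Proof. by move=> sV Vf; apply: Ck_local => y /sV Vy; exists V. Qed.

Lemma Ck_eq (W : normedModType R) k V (f g : 'rV[R]_m -> W) : open V ->
  (forall y, V y -> f y = g y) -> Ck k V f -> Ck k V g.
Proof.
move=> oV; elim: k f g => [|k IH] f g fg.
  move=> cf y Vy; have := cf _ Vy; rewrite /prop_for /continuous_at (fg _ Vy).
  move=> cfy; apply: cvg_trans cfy; apply: (near_eq_cvg (F := nbhs y)).
  near=> z; apply: fg; near: z; exact: open_nbhs_nbhs.
have nfg y : V y -> \forall z \near y, f z = g z.
  move=> Vy; near=> z; apply: fg; near: z; exact: open_nbhs_nbhs.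
move=> [df Df]; split=> [y Vy|v].
  apply: near_eq_differentiable (df y Vy); exact: nfg.
apply: IH (Df v) => y Vy; apply: near_eq_derive; exact: nfg.
Unshelve. all: end_near. Qed.

Lemma CkS (W : normedModType R) k V (f : 'rV[R]_m -> W) :
  Ck k.+1 V f -> Ck k V f.
Proof.
elim: k f => [|k IH] f [df Df].
  by move=> y /df; exact: differentiable_continuous.
by split=> // v; apply: IH.
Qed.

Lemma Ck_cst (W : normedModType R) k V (a : W) : Ck k V (fun=> a).
Proof.
elim: k a => [|k IH] a.
  by move=> y _; exact: cst_continuous.
split=> [y _|v]; first exact: differentiable_cst.
have -> : (fun y => 'D_v (fun=> a) y) = (fun=> 0 : W) by apply/funext => y; exact: derive_cst.
exact: IH.
Qed.

Lemma CkD (W : normedModType R) k V (f g : 'rV[R]_m -> W) : open V ->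
  Ck k V f -> Ck k V g -> Ck k V (fun y => f y + g y).
Proof.
move=> oV; elim: k f g => [|k IH] f g.
  by move=> cf cg y Vy; exact: (continuousD (cf _ Vy) (cg _ Vy)).
move=> [df Df] [dg Dg]; split=> [y Vy|v].
  by apply: differentiableD; [exact: df|exact: dg].
apply: Ck_eq (IH _ _ (Df v) (Dg v)) => // y Vy.
by rewrite -[RHS]/('D_v (f + g) y) deriveD //; apply: diff_derivable;
  [exact: df|exact: dg].
Qed.

Lemma Ck_sum (W : normedModType R) k V (I : Type) (r : seq I) (P : pred I)
    (f : I -> 'rV[R]_m -> W) : open V ->
  (forall i, Ck k V (f i)) -> Ck k V (fun y => \sum_(i <- r | P i) f i y).
Proof.
move=> oV Hf; elim: r => [|i r IH].
  by apply: Ck_eq (Ck_cst _ _ 0) => // y _; rewrite big_nil.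
case: (boolP (P i)) => Pi.
  by apply: Ck_eq (CkD oV (Hf i) IH) => // y _; rewrite big_cons Pi.
by apply: Ck_eq IH => // y _; rewrite big_cons (negbTE Pi).
Qed.

Lemma Ck_linear (W W' : normedModType R) (L : {linear W -> W'}) k V
    (f : 'rV[R]_m -> W) : open V -> continuous L ->
  Ck k V f -> Ck k V (fun y => L (f y)).
Proof.
move=> oV cL; elim: k f => [|k IH] f.
  by move=> cf y Vy; exact: (continuous_comp (cf _ Vy) (cL _)).
move=> [df Df]; split=> [y Vy|v].
  apply: differentiable_comp; first exact: df.
  exact: linear_differentiable.
apply: Ck_eq (IH _ (Df v)) => // y Vy.
have dL z : differentiable L z by exact: linear_differentiable.
have dfy := df y Vy.
rewrite -[RHS]/('D_v (L \o f) y) (deriveE _ dfy) deriveE.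
  by rewrite [in RHS]diff_comp //= (diff_lin _ cL).
exact: differentiable_comp.
Qed.

Lemma CkM k V (f g : 'rV[R]_m -> R) : open V ->
  Ck k V f -> Ck k V g -> Ck k V (fun y => f y * g y).
Proof.
move=> oV; elim: k f g => [|k IH] f g.
  by move=> cf cg y Vy; exact: (continuousM (cf _ Vy) (cg _ Vy)).
move=> hf hg; have [df Df] := hf; have [dg Dg] := hg.
split=> [y Vy|v].
  by apply: differentiableM; [exact: df|exact: dg].
have := CkD oV (IH _ _ (CkS hf) (Dg v)) (IH _ _ (CkS hg) (Df v)).
apply: Ck_eq => // y Vy.
by rewrite -[RHS]/('D_v (f * g) y) deriveM //; apply: diff_derivable;
  [exact: df|exact: dg].
Qed.

Lemma CkV k V (f : 'rV[R]_m -> R) : open V -> (forall y, V y -> f y != 0) ->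
  Ck k V f -> Ck k V (fun y => (f y)^-1).
Proof.
move=> oV f0; elim: k => [|k IH].
  by move=> cf y Vy; exact: (continuousV (f0 _ Vy) (cf _ Vy)).
move=> hf; have [df Df] := hf; have hV := IH (CkS hf); split=> [y Vy|v].
  by apply: differentiableV; [exact: df|exact: f0].
have := CkM oV (CkM oV (CkM oV hV hV) (Ck_cst k V (-1 : R))) (Df v).
apply: Ck_eq => // y Vy.
rewrite [RHS]deriveV; [|exact: f0|by apply: diff_derivable; exact: df].
by rewrite -exprVn expr2 mulrN1.
Qed.

Lemma Ck_coordP k V p (f : 'rV[R]_m -> 'rV[R]_p) : open V ->
  Ck k V f <-> forall j, Ck k V (fun y => f y 0 j : R).
Proof.
move=> oV; split=> [hf j|hf].
  have @L : {linear 'rV[R]_p -> R}.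
    exists (fun u : 'rV[R]_p => u 0 j); do 2![eexists]; do ?[constructor];
     by rewrite ?mxE// => ? *; rewrite ?mxE//; move=> ?; rewrite !mxE.
  have : Ck k V (fun y => L (f y)).
    by apply: Ck_linear => //; exact: coord_continuous.
  exact.
apply: (@Ck_eq _ _ _ (fun y => \sum_(j < p) f y 0 j *: delta_mx 0 j)) => //.
  by move=> y Vy; rewrite [RHS]row_sum_delta.
apply: Ck_sum => // j.
have @L : {linear R -> 'rV[R]_p}.
  exists (fun a : R => a *: delta_mx 0 j); do 2![eexists]; do ?[constructor].
  - by rewrite scale0r.
  - by move=> a b; rewrite scalerDl.
  - by move=> a b; rewrite scalerA.
apply: (Ck_linear (L:=L)) => //; exact: scalel_continuous.
Qed.

End ContinuouslyDifferentiable.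

Lemma derive_coord (R : realType) m p (f : 'rV[R]_m -> 'rV[R]_p) y v j :
  differentiable f y -> 'D_v (fun z => f z 0 j : R) y = ('D_v f y) 0 j.
Proof.
move=> df.
have dc z := @differentiable_coord R _ _ z 0 j : differentiable (fun N : 'rV[R]_p => N 0 j : R) z.
rewrite -[X in 'D_v X y]/((fun N : 'rV[R]_p => N 0 j : R) \o f).
rewrite !deriveE //; last exact: differentiable_comp.
rewrite diff_comp //=.
have @L : {linear 'rV[R]_p -> R}.
  exists (fun u : 'rV[R]_p => u 0 j); do 2![eexists]; do ?[constructor];
   by rewrite ?mxE// => ? *; rewrite ?mxE//; move=> ?; rewrite !mxE.
have -> : (fun N : 'rV[R]_p => N 0 j : R) = L by [].
by rewrite diff_lin //; exact: coord_continuous.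
Qed.

Lemma derive_compE (R : realType) m p (W : normedModType R)
    (f : 'rV[R]_p -> W) (g : 'rV[R]_m -> 'rV[R]_p) y v :
  differentiable g y -> differentiable f (g y) ->
  'D_v (f \o g) y = 'D_('D_v g y) f (g y).
Proof.
move=> dg df; rewrite !deriveE //; last exact: differentiable_comp.
by rewrite diff_comp.
Qed.

Lemma derive_row_sum (R : realType) p (W : normedModType R)
    (f : 'rV[R]_p -> W) x (u : 'rV[R]_p) : differentiable f x ->
  'D_u f x = \sum_j u 0 j *: 'D_(delta_mx 0 j) f x.
Proof.
move=> df; rewrite deriveE // {1}(row_sum_delta u) linear_sum.
by apply: eq_bigr => j _; rewrite linearZ deriveE.
Qed.

(** By the chain rule the derivative of f o g along v is the sum of the products
    of the coordinates of the derivative of g with the partial derivatives of f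
    composed with g; the latter are of class C^(k-1) by induction. *)
Lemma Ck_comp (R : realType) m p k (V : set 'rV[R]_m) (V' : set 'rV[R]_p)
    (f : 'rV[R]_p -> R) (g : 'rV[R]_m -> 'rV[R]_p) :
  open V -> (forall y, V y -> V' (g y)) ->
  Ck k V' f -> Ck k V g -> Ck k V (f \o g).
Proof.
move=> oV gV; elim: k f => [|k IH] f.
  by move=> cf cg y Vy; exact: (continuous_comp (cg _ Vy) (cf _ (gV _ Vy))).
move=> hf hg; have [df Df] := hf; have [dg Dg] := hg.
split=> [y Vy|v].
  by apply: differentiable_comp; [exact: dg|apply: df; exact: gV].
apply: (@Ck_eq _ _ _ _ _ (fun y => \sum_(j < p)
    ('D_v g y) 0 j * 'D_(delta_mx 0 j) f (g y))) => //.
  move=> y Vy; have dgy := dg y Vy; have dfy := df (g y) (gV y Vy).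
  by rewrite (derive_compE _ dgy dfy) (derive_row_sum _ dfy).
apply: Ck_sum => // j; apply: CkM => //.
  by have /Ck_coordP := Dg v; apply.
by apply: (IH (fun x => 'D_(delta_mx 0 j) f x)); [exact: Df|exact: CkS].
Qed.

Section SmoothAt.
Variables (R : realType) (m : nat).

(** One neighbourhood has to serve all k: composition and inversion then need no
    shrinking at each order of differentiation. *)
Definition smooth_at (W : normedModType R) (f : 'rV[R]_m -> W) (y : 'rV[R]_m) :=
  exists V, [/\ open V, V y & forall k, Ck k V f].

Lemma smooth_onP p (V : set 'rV[R]_m) (f : 'rV[R]_m -> 'rV[R]_p) : open V ->
  smooth_on V f <-> forall y, V y -> smooth_at f y.
Proof.
move=> oV; split=> [sf y Vy|sf k].
  by exists V; split=> // k; exact/Ck_onE.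
by apply/Ck_onE/Ck_local => y /sf[V' [_ V'y Hf]]; exists V'.
Qed.

Lemma smooth_at_near (W : normedModType R) (f : 'rV[R]_m -> W) y :
  smooth_at f y -> \forall z \near y, smooth_at f z.
Proof.
move=> [V [oV Vy Hf]]; apply: filterS (open_nbhs_nbhs (conj oV Vy)) => z Vz.
by exists V.
Qed.

Lemma smooth_at_differentiable (W : normedModType R) (f : 'rV[R]_m -> W) y :
  smooth_at f y -> differentiable f y.
Proof. by move=> [V [oV Vy Hf]]; have [df _] := Hf 1%N; exact: df. Qed.

Lemma smooth_at_continuous (W : normedModType R) (f : 'rV[R]_m -> W) y :
  smooth_at f y -> {for y, continuous f}.
Proof. by move=> /smooth_at_differentiable/differentiable_continuous. Qed.

Lemma smooth_at_derive (W : normedModType R) (f : 'rV[R]_m -> W) y v :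
  smooth_at f y -> smooth_at (fun z => 'D_v f z) y.
Proof.
by move=> [V [oV Vy Hf]]; exists V; split=> // k; have [_] := Hf k.+1; exact.
Qed.

Lemma smooth_at_eq (W : normedModType R) (f g : 'rV[R]_m -> W) y :
  (\forall z \near y, f z = g z) -> smooth_at f y -> smooth_at g y.
Proof.
move=> /near_open[V1 [oV1 V1y fg]] [V [oV Vy Hf]].
exists (V1 `&` V); split; [exact: openI|by []|move=> k].
have := Ck_sub (@subIsetr _ V1 V) (Hf k).
by apply: Ck_eq; [exact: openI|move=> z [/fg]].
Qed.

Lemma smooth_at_cst (W : normedModType R) (a : W) y :
  smooth_at (fun _ : 'rV[R]_m => a) y.
Proof. by exists setT; split=> // [|k]; [exact: openT|exact: Ck_cst]. Qed.

Lemma smooth_atD (W : normedModType R) (f g : 'rV[R]_m -> W) y :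
  smooth_at f y -> smooth_at g y -> smooth_at (fun z => f z + g z) y.
Proof.
move=> [V1 [oV1 V1y Hf]] [V [oV Vy Hg]].
exists (V1 `&` V); split; [exact: openI|by []|move=> k].
apply: CkD; [exact: openI|exact: Ck_sub (Hf k)|exact: Ck_sub (Hg k)].
Qed.

Lemma smooth_at_sum (W : normedModType R) (I : Type) (r : seq I) (P : pred I)
    (f : I -> 'rV[R]_m -> W) y : (forall i, smooth_at (f i) y) ->
  smooth_at (fun z => \sum_(i <- r | P i) f i z) y.
Proof.
move=> Hf; elim: r => [|i r IH].
  apply: smooth_at_eq (smooth_at_cst 0 y); near=> z; by rewrite big_nil.
case: (boolP (P i)) => Pi.
  apply: smooth_at_eq (smooth_atD (Hf i) IH); near=> z; by rewrite big_cons Pi.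
apply: smooth_at_eq IH; near=> z; by rewrite big_cons (negbTE Pi).
Unshelve. all: end_near. Qed.

Lemma smooth_atM (f g : 'rV[R]_m -> R) y :
  smooth_at f y -> smooth_at g y -> smooth_at (fun z => f z * g z) y.
Proof.
move=> [V1 [oV1 V1y Hf]] [V [oV Vy Hg]].
exists (V1 `&` V); split; [exact: openI|by []|move=> k].
apply: CkM; [exact: openI|exact: Ck_sub (Hf k)|exact: Ck_sub (Hg k)].
Qed.

Lemma smooth_at_prod (I : Type) (r : seq I) (P : pred I)
    (f : I -> 'rV[R]_m -> R) y : (forall i, smooth_at (f i) y) ->
  smooth_at (fun z => \prod_(i <- r | P i) f i z) y.
Proof.
move=> Hf; elim: r => [|i r IH].
  apply: smooth_at_eq (smooth_at_cst (1 : R) y); near=> z; by rewrite big_nil.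
case: (boolP (P i)) => Pi.
  apply: smooth_at_eq (smooth_atM (Hf i) IH); near=> z; by rewrite big_cons Pi.
apply: smooth_at_eq IH; near=> z; by rewrite big_cons (negbTE Pi).
Unshelve. all: end_near. Qed.

Lemma continuous_neq0 (f : 'rV[R]_m -> R) y : {for y, continuous f} ->
  f y != 0 -> \forall z \near y, f z != 0.
Proof.
move=> cf f0; have : nbhs (f y) [set r | r != 0].
  by apply: open_nbhs_nbhs; split=> //; exact: open_neq.
exact: cf.
Qed.

Lemma smooth_atV (f : 'rV[R]_m -> R) y : f y != 0 ->
  smooth_at f y -> smooth_at (fun z => (f z)^-1) y.
Proof.
move=> f0 sf; have := continuous_neq0 (smooth_at_continuous sf) f0.
move=> /near_open[V1 [oV1 V1y fV]]; have [V [oV Vy Hf]] := sf.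
exists (V1 `&` V); split; [exact: openI|by []|move=> k].
by apply: CkV; [exact: openI|move=> z [/fV]|exact: Ck_sub (Hf k)].
Qed.

Lemma smooth_at_coordP p (f : 'rV[R]_m -> 'rV[R]_p) y :
  smooth_at f y <-> forall j, smooth_at (fun z => f z 0 j : R) y.
Proof.
split=> [[V [oV Vy Hf]] j|Hf].
  exists V; split=> // k; by have /(Ck_coordP _ _ oV) := Hf k; apply.
apply: (@smooth_at_eq _ (fun z => \sum_(j < p) f z 0 j *: delta_mx 0 j)).
  by near=> z; rewrite [RHS]row_sum_delta.
apply: smooth_at_sum => j; have [V [oV Vy Hj]] := Hf j.
exists V; split=> // k; apply/Ck_coordP => // i.
apply: (@Ck_eq _ _ _ _ _ (fun z => f z 0 j * (delta_mx 0 j : 'rV[R]_p) 0 i)) => //.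
  by move=> z Vz; rewrite [RHS]mxE.
by apply: CkM => //; exact: Ck_cst.
Unshelve. all: end_near. Qed.

Lemma smooth_at_id y : smooth_at (fun z : 'rV[R]_m => z) y.
Proof.
exists setT; split; [exact: openT|by []|].
case=> [|k]; first by move=> z _; apply: cvg_id.
split=> [z _|v]; first exact: ex_diff.
have -> : (fun y => 'D_v id y) = (fun=> v) by apply/funext => z; exact: derive_id.
exact: Ck_cst.
Qed.

End SmoothAt.

Lemma smooth_at_comp (R : realType) m p q (f : 'rV[R]_p -> 'rV[R]_q)
    (g : 'rV[R]_m -> 'rV[R]_p) y :
  smooth_at f (g y) -> smooth_at g y -> smooth_at (fun z => f (g z)) y.
Proof.
move=> sf sg; apply/smooth_at_coordP => j.
have [V' [oV' V'y Hf]] : smooth_at (fun z => f z 0 j : R) (g y).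
  by have /smooth_at_coordP := sf; exact.
have := smooth_at_continuous sg (open_nbhs_nbhs (conj oV' V'y)).
move=> /near_open[V1 [oV1 V1y V1V']].
have [V [oV Vy Hg]] := sg.
exists (V1 `&` V); split; [exact: openI|by []|move=> k].
apply: (@Ck_comp _ _ _ _ _ V' (fun z => f z 0 j : R)) => //.
- exact: openI.
- by move=> z [/V1V'].
- exact: Ck_sub (Hg k).
Qed.

Lemma smooth_at_linear (R : realType) m p q (L : {linear 'rV[R]_p -> 'rV[R]_q})
    (f : 'rV[R]_m -> 'rV[R]_p) y :
  smooth_at f y -> smooth_at (fun z => L (f z)) y.
Proof.
move=> [V [oV Vy Hf]]; exists V; split=> // k.
by apply: Ck_linear => //; exact: linear_rV_continuous.
Qed.

Lemma smooth_at_mulmxr (R : realType) m p q (M : 'M[R]_(p, q))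
    (f : 'rV[R]_m -> 'rV[R]_p) y :
  smooth_at f y -> smooth_at (fun z => f z *m M) y.
Proof. exact: (smooth_at_linear (mulmxr M)). Qed.

Lemma smooth_at_lsubmx (R : realType) m p q (f : 'rV[R]_m -> 'rV[R]_(p + q)) y :
  smooth_at f y -> smooth_at (fun z => lsubmx (f z)) y.
Proof. exact: (smooth_at_linear (lsubmx)). Qed.

Lemma smooth_at_rsubmx (R : realType) m p q (f : 'rV[R]_m -> 'rV[R]_(p + q)) y :
  smooth_at f y -> smooth_at (fun z => rsubmx (f z)) y.
Proof. exact: (smooth_at_linear (rsubmx)). Qed.

Lemma smooth_at_row_mx (R : realType) m p q (f : 'rV[R]_m -> 'rV[R]_p)
    (g : 'rV[R]_m -> 'rV[R]_q) y :
  smooth_at f y -> smooth_at g y -> smooth_at (fun z => row_mx (f z) (g z)) y.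
Proof.
move=> /smooth_at_coordP sf /smooth_at_coordP sg; apply/smooth_at_coordP => j.
case: (split_ordP j) => i ->.
  by apply: smooth_at_eq (sf i); near=> z; rewrite row_mxEl.
by apply: smooth_at_eq (sg i); near=> z; rewrite row_mxEr.
Unshelve. all: end_near. Qed.

(** * Jacobian matrices and the mean value inequality *)

Section SmoothMatrices.
Variables (R : realType) (m : nat).

Lemma smooth_at_det n (M : 'rV[R]_m -> 'M[R]_n) y :
  (forall i j, smooth_at (fun z => M z i j : R) y) ->
  smooth_at (fun z => \det (M z)) y.
Proof.
move=> sM; apply: smooth_at_sum => s; apply: smooth_atM.
  exact: smooth_at_cst.
by apply: smooth_at_prod => i; exact: sM.
Qed.

(** By Cramer's rule the entries of the inverse are rational functions of the
    entries. *)
Lemma smooth_at_invmx n (M : 'rV[R]_m -> 'M[R]_n) y :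
  M y \in unitmx -> (forall i j, smooth_at (fun z => M z i j : R) y) ->
  forall i j, smooth_at (fun z => invmx (M z) i j : R) y.
Proof.
move=> uM sM i j; have sd := smooth_at_det sM.
have d0 : \det (M y) != 0 by move: uM; rewrite unitmxE unitfE.
have nd := continuous_neq0 (smooth_at_continuous sd) d0.
have sa : smooth_at (fun z => (\det (M z))^-1 * (\adj (M z)) i j) y.
  apply: smooth_atM; first exact: smooth_atV.
  apply: (@smooth_at_eq _ _ _ (fun z => (-1) ^+ (j + i) *
     \det (row' j (col' i (M z))))).
    by near=> z; rewrite mxE.
  apply: smooth_atM; first exact: smooth_at_cst.
  apply: smooth_at_det => k l; apply: smooth_at_eq (sM (lift j k) (lift i l)).
  by near=> z; rewrite !mxE.
apply: smooth_at_eq sa; near=> z.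
have zu : M z \in unitmx by rewrite unitmxE unitfE; near: z.
by rewrite /invmx zu [RHS]mxE.
Unshelve. all: end_near. Qed.

End SmoothMatrices.

(** Agrees with [jacobian] where f is differentiable; here the entries are
    directional derivatives by definition, hence smooth wherever f is. *)
Definition jac (R : realType) m p (f : 'rV[R]_m -> 'rV[R]_p) (z : 'rV[R]_m) :
  'M[R]_(m, p) := \matrix_(i, j) ('D_(delta_mx 0 i) f z) 0 j.

Lemma jacE (R : realType) m p (f : 'rV[R]_m -> 'rV[R]_p) z v :
  differentiable f z -> 'D_v f z = v *m jac f z.
Proof.
move=> df; rewrite (derive_row_sum _ df); apply/rowP => j.
by rewrite summxE mxE; apply: eq_bigr => i _; rewrite !mxE.
Qed.

Lemma smooth_at_jac (R : realType) m p (f : 'rV[R]_m -> 'rV[R]_p) z i j :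
  smooth_at f z -> smooth_at (fun z => jac f z i j : R) z.
Proof.
move=> sf.
have := smooth_at_derive (delta_mx 0 i) sf => /smooth_at_coordP/(_ j).
by apply: smooth_at_eq; near=> x; rewrite mxE.
Unshelve. all: end_near. Qed.

Lemma rV_norm_le (R : realType) p (u : 'rV[R]_p) (e : R) : 0 <= e ->
  (forall j, `|u 0 j| <= e) -> `|u| <= e.
Proof.
move=> e0 H; rewrite [leLHS]/Num.norm /= mx_normrE.
by apply/bigmax_leP; split=> //= -[i j] _ /=; rewrite ord1.
Qed.

Lemma rV_norm_ge (R : realType) p (u : 'rV[R]_p) j : `|u 0 j| <= `|u|.
Proof.
rewrite [leRHS]/Num.norm /= mx_normrE.
exact: (le_bigmax _ (fun ij : 'I_1 * 'I_p => `|u ij.1 ij.2|) (0, j)).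
Qed.

Section MeanValue.
Variables (R : realType) (m p : nat).

(** The one-variable mean value theorem applied to each coordinate of f along
    the segment; the norm is the maximum norm. *)
Lemma mean_value_ineq (f : 'rV[R]_m -> 'rV[R]_p) (x y : 'rV[R]_m) (e : R) : 0 <= e ->
  (forall t, 0 <= t <= 1 -> differentiable f (y + t *: (x - y)) /\
     `|'D_(x - y) f (y + t *: (x - y))| <= e) ->
  `|f x - f y| <= e.
Proof.
move=> e0 H; apply: rV_norm_le => // j.
pose g (t : R) : R := f (y + t *: (x - y)) 0 j.
have dg (t : R) : 0 <= t <= 1 ->
    is_derive t 1 g (('D_(x - y) f (y + t *: (x - y))) 0 j).
  move=> /H [df _].
  have dl : is_diff t (fun s : R => y + s *: (x - y)) (fun s => s *: (x - y)).
    have : is_diff t ((cst y : R -> _) + ( *:%R ^~ (x - y))) (0 + ( *:%R ^~ (x - y))).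
      exact: is_diffD.
    by rewrite add0r.
  have dfl : differentiable (f \o (fun s : R => y + s *: (x - y))) t.
    by apply: differentiable_comp => //; exact: ex_diff.
  have dc z := @differentiable_coord R _ _ z 0 j : differentiable (fun N : 'rV[R]_p => N 0 j : R) z.
  have dgt : differentiable g t.
    exact: (differentiable_comp dfl (dc _)).
  apply: DeriveDef; first exact/derivable1_diffP.
  rewrite deriveE // -[g]/((fun z : 'rV[R]_m => f z 0 j : R) \o (fun s : R => y + s *: (x - y))).
  rewrite diff_comp /=; last 2 first.
  - exact: ex_diff.
  - by apply: (differentiable_comp df (dc _)).
  rewrite diff_val scale1r -(derive_coord _ _ df) deriveE //.
  exact: (differentiable_comp df (dc _)).
have [||c c01] := @MVT_segment R g (fun t => ('D_(x - y) f (y + t *: (x - y))) 0 j) 0 1 ler01.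
- by move=> t /itvP tI; apply: dg; rewrite !tI.
- apply: derivable_within_continuous => t; rewrite in_itv /= => /dg dgt.
  exact: (@ex_derive _ _ _ _ _ _ _ dgt).
rewrite subr0 mulr1 /g scale1r addrCA subrr addr0 scale0r addr0 => gE.
rewrite !mxE gE; apply: le_trans (rV_norm_ge _ _) _.
by have [] := H c; rewrite // !(itvP c01).
Qed.

End MeanValue.

(** * The inverse function theorem *)

(** The join of completeness and the norm on row vectors, needed for the fixed
    point theorem. *)
HB.instance Definition _ (R : realType) m := Complete.on (matrix R 1 m).

Section InverseFunction.
Variables (R : realType) (m : nat) (f : 'rV[R]_m -> 'rV[R]_m) (x0 : 'rV[R]_m).
Hypothesis sf : smooth_at f x0.
Hypothesis df0 : forall v, 'D_v f x0 = v.

(** The partial derivatives of f are continuous, and at x0 they are the basis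
    vectors. *)
Lemma near_identity_derivative :
  \forall z \near x0, forall v, `|'D_v f z - v| <= 2^-1 * `|v|.
Proof.
(* Each of the m partial derivatives may be off by at most 1 / (2 m); m + 1
   avoids a division by zero. *)
pose e : R := (2 * m.+1%:R)^-1.
have e0 : 0 < e by rewrite invr_gt0 mulr_gt0 ?ltr0n.
have H : \forall z \near x0, forall i : 'I_m,
    `|'D_(delta_mx 0 i) f z - delta_mx 0 i| < e.
  apply: (@filter_forall _ _ (fun (i : 'I_m) z =>
    `|'D_(delta_mx 0 i) f z - delta_mx 0 i| < e) (nbhs x0) _) => i.
  have := smooth_at_continuous (smooth_at_derive (delta_mx 0 i) sf).
  rewrite /prop_for /continuous_at df0 => /cvgrPdist_lt/(_ e e0).
  by apply: filterS => z; rewrite distrC.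
near=> z => v.
have Hz i : `|'D_(delta_mx 0 i) f z - delta_mx 0 i| < e.
  move: i; near: z; exact: H.
have dz : differentiable f z.
  by near: z; apply: filterS (smooth_at_near sf) => z /smooth_at_differentiable.
rewrite (derive_row_sum _ dz) {2}(row_sum_delta v) -sumrB.
apply: le_trans (ler_norm_sum _ _ _) _.
apply: (@le_trans _ _ (\sum_(i < m) e * `|v|)).
  apply: ler_sum => i _; rewrite -scalerBr normrZ mulrC.
  by apply: ler_pM => //; [exact: ltW|exact: rV_norm_ge].
rewrite sumr_const card_ord -[leLHS]mulr_natl mulrA ler_wpM2r //.
rewrite /e invfM mulrCA ler_piMr ?invr_ge0 ?ler0n //.
by rewrite ler_pdivrMr ?ltr0n // mul1r ler_nat.
Unshelve. all: end_near. Qed.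

Variable P : 'rV[R]_m -> Prop.
Hypothesis nP : \forall z \near x0, P z.

Lemma good_radius : exists r : R, 0 < r /\ forall z, `|x0 - z| < r ->
  [/\ P z, smooth_at f z & forall v, `|'D_v f z - v| <= 2^-1 * `|v|].
Proof.
have : \forall z \near x0,
  [/\ P z, smooth_at f z & forall v, `|'D_v f z - v| <= 2^-1 * `|v|].
  near=> z; split.
  - by near: z.
  - by near: z; exact: smooth_at_near.
  - by near: z; exact: near_identity_derivative.
move=> /nbhs_ballP[r /= r0 H]; exists r; split=> // z zr; apply: H.
by rewrite -ball_normE.
Unshelve. all: end_near. Qed.

Section Radius.
Variable r : R.
Hypothesis r0 : 0 < r.
Hypothesis Hr : forall z, `|x0 - z| < r ->
  [/\ P z, smooth_at f z & forall v, `|'D_v f z - v| <= 2^-1 * `|v|].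

Let W : set 'rV[R]_m := [set z | `|x0 - z| < r].

Let openW : open W.
Proof.
rewrite (_ : W = ball x0 r); first exact: ball_open.
by rewrite -ball_normE.
Qed.

(** f - id has Lipschitz constant 1/2 on the ball W. *)
Let perturbation (x y : 'rV[R]_m) : W x -> W y ->
  `|(f x - x) - (f y - y)| <= 2^-1 * `|x - y|.
Proof.
move=> Wx Wy.
apply: (@mean_value_ineq _ _ _ (fun z => f z - z) x y).
  by rewrite mulr_ge0 // invr_ge0.
move=> t /andP[t0 t1].
have [_ sft Dft] : [/\ P (y + t *: (x - y)), smooth_at f (y + t *: (x - y))
   & forall v, `|'D_v f (y + t *: (x - y)) - v| <= 2^-1 * `|v|].
  apply: Hr.
  have -> : x0 - (y + t *: (x - y)) = (1 - t) *: (x0 - y) + t *: (x0 - x).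
    apply/rowP => j; rewrite !mxE; ring.
  apply: le_lt_trans (ler_normD _ _) _.
  rewrite !normrZ ger0_norm ?subr_ge0 // ger0_norm //.
  have -> : r = (1 - t) * r + t * r by rewrite -mulrDl subrK mul1r.
  move: t0; rewrite le_eqVlt => /predU1P[<-|t0].
    by rewrite subr0 !mul1r !mul0r !addr0.
  by apply: ler_ltD; [rewrite ler_wpM2l ?subr_ge0 // ltW|rewrite ltr_pM2l].
have dft := smooth_at_differentiable sft.
have did : differentiable (@id 'rV[R]_m) (y + t *: (x - y)) by exact: ex_diff.
split; first exact: (differentiableB dft did).
have -> : 'D_(x - y) (fun z => f z - z) (y + t *: (x - y)) =
    'D_(x - y) f (y + t *: (x - y)) - (x - y).
  have fd : derivable f (y + t *: (x - y)) (x - y) by exact: diff_derivable.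
  have gd : derivable id (y + t *: (x - y)) (x - y) by exact: diff_derivable.
  by rewrite [LHS](deriveB fd gd) derive_id.
exact: Dft.
Qed.

Let expanding (x y : 'rV[R]_m) : W x -> W y -> `|x - y| <= 2 * `|f x - f y|.
Proof.
move=> Wx Wy; have := perturbation Wx Wy.
have -> : (f x - x) - (f y - y) = (f x - f y) - (x - y).
  by rewrite !opprD !opprK addrACA.
move=> H; have := ler_distD (f x - f y) (x - y) 0.
rewrite !subr0 [`|x - y - _|]distrC => H1.
have : `|x - y| <= 2^-1 * `|x - y| + `|f x - f y|.
  by apply: le_trans H1 _; rewrite lerD2r.
lra.
Qed.

(** To solve f z = y near f x1, iterate z |-> y + z - f z: by [perturbation] it
    is a contraction of a small closed ball around x1. *)
Let open_image : open (f @` W).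
Proof.
rewrite openE => _ [x1 Wx1 <-].
pose s := (r - `|x0 - x1|) / 2.
have s0 : 0 < s by rewrite divr_gt0 // subr_gt0.
pose U : set 'rV[R]_m := [set z | `|x1 - z| <= s].
have UW z : U z -> W z.
  rewrite /U /W /= => Uz; have := ler_distD x1 x0 z.
  by move: Wx1; rewrite /W /= /s in Uz * => *; lra.
apply/nbhs_ballP; exists (s / 2) => /=; first by rewrite divr_gt0.
move=> y; rewrite -ball_normE /= => yb.
pose T z := y + z - f z.
have TU : set_fun U U T.
  move=> z Uz; rewrite /U /= /T.
  have -> : x1 - (y + z - f z) = (f x1 - y) + ((f z - z) - (f x1 - x1)).
    apply/rowP => j; rewrite !mxE; ring.
  apply: le_trans (ler_normD _ _) _.
  have := perturbation (UW _ Uz) Wx1; rewrite [`|z - x1|]distrC.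
  move: Uz; rewrite /U /= => *; lra.
pose TF : {fun U >-> U} := HB.pack T (isFun.Build _ _ _ _ T TU).
have half0 : 0 <= 2^-1 :> R by rewrite invr_ge0.
have ctr : is_contraction TF.
  exists (NngNum half0); split; first by rewrite /=; lra.
  move=> [a b] [Ua Ub] /=; rewrite /T.
  have -> : y + a - f a - (y + b - f b) = - ((f a - a) - (f b - b)).
    apply/rowP => j; rewrite !mxE; ring.
  by rewrite normrN; apply: perturbation; exact: UW.
have clU : closed U.
  rewrite (_ : U = closed_ball x1 s); first exact: closed_ball_closed.
  by rewrite closed_ballE.
have U0 : U !=set0 by exists x1; rewrite /U /= subrr normr0 ltW.
have [z Uz zE] := banach_fixed_point ctr clU U0.
exists z; first exact: UW.
by move: zE; rewrite /= /T addrAC => /eqP; rewrite eq_sym -subr_eq0 addrK subr_eq0 => /eqP.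
Qed.

Let g (y : 'rV[R]_m) : 'rV[R]_m := get [set x | W x /\ f x = y].

Let gP y : (f @` W) y -> W (g y) /\ f (g y) = y.
Proof.
move=> [x Wx fx]; exact: (@getPex _ [set x | W x /\ f x = y] (ex_intro _ x (conj Wx fx))).
Qed.

Let gK x : W x -> g (f x) = x.
Proof.
move=> Wx; have [Wg fg] := gP (ex_intro2 _ _ x Wx erefl).
apply/subr0_eq/normr0_eq0/le_anti; rewrite normr_ge0 andbT.
by apply: le_trans (expanding Wg Wx) _; rewrite fg subrr normr0 mulr0.
Qed.

(** If v is in the kernel of the jacobian, the bound on the derivative reads
    |v| <= |v| / 2. *)
Let jac_unit z : W z -> jac f z \in unitmx.
Proof.
move=> Wz; have [_ sz Dz] := Hr Wz.
rewrite -row_free_unit -kermx_eq0; apply/eqP/row_matrixP => i; rewrite row0.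
set v := row i _; have vJ : v *m jac f z = 0.
  by rewrite -row_mul mulmx_ker row0.
have := Dz v; rewrite (jacE _ (smooth_at_differentiable sz)) vJ sub0r normrN => Hv.
apply/normr0_eq0/le_anti; rewrite normr_ge0 andbT.
have := normr_ge0 v; lra.
Qed.

(** With x = g y, x' = g y' and J the jacobian at x, the error
    x' - x - (y' - y) J^-1 is -(f x' - f x - (x' - x) J) J^-1, which is
    o(x' - x), hence o(y' - y) because g is Lipschitz. *)
Let g_diff y v : (f @` W) y ->
  differentiable g y /\ 'D_v g y = v *m invmx (jac f (g y)).
Proof.
move=> Wy; have [Wg fg] := gP Wy; have [_ sz _] := Hr Wg.
have dz := smooth_at_differentiable sz.
pose L : {linear 'rV[R]_m -> 'rV[R]_m} := mulmxr (invmx (jac f (g y))).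
have cL : continuous L by exact: linear_rV_continuous.
suff [dg Dg] : differentiable g y /\ 'd g y = L :> (_ -> _).
  by split=> //; rewrite deriveE // Dg.
apply: estimate_diff => // e e0.
have [C C0 HC] := linear_lipschitz cL.
pose e' := e / (2 * C).
have e'0 : 0 < e' by rewrite divr_gt0 // mulr_gt0.
have cg : {for y, continuous g}.
  apply/(@cvgrPdist_lt _ _ _ (nbhs y) _ g (g y)) => d d0; near=> y'.
  have Wy' : (f @` W) y' by near: y'; exact: (open_near open_image Wy).
  have [Wg' fg'] := gP Wy'.
  apply: le_lt_trans (expanding Wg Wg') _; rewrite fg fg' -ltr_pdivlMl // mulrC.
  near: y'; apply/nbhs_ballP; exists (d / 2) => /=; first by rewrite divr_gt0.
  by move=> y'; rewrite -ball_normE.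
have := cg _ (diff_estimate dz e'0); rewrite /prop_near1 nbhs_simpl => H.
near=> y'.
have Wy' : (f @` W) y' by near: y'; exact: (open_near open_image Wy).
have [Wg' fg'] := gP Wy'.
have est : `|f (g y') - f (g y) - 'd f (g y) (g y' - g y)| <= e' * `|g y' - g y|.
  by near: y'; exact: H.
have -> : g y' - g y - L (y' - y) =
   - L (f (g y') - f (g y) - 'd f (g y) (g y' - g y)).
  rewrite fg fg' -deriveE // (jacE _ dz) [in RHS]linearB opprB.
  by rewrite [X in _ = X - _]/= mulmxK //; exact: jac_unit.
rewrite normrN; apply: le_trans (HC _) _.
apply: (@le_trans _ _ (C * (e' * (2 * `|y' - y|)))).
  rewrite ler_pM2l //; apply: le_trans est _; rewrite ler_pM2l //.
  by apply: le_trans (expanding Wg' Wg) _; rewrite fg fg'.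
rewrite le_eqVlt; apply/orP; left; apply/eqP; rewrite /e'.
by field; rewrite gt_eqF.
Unshelve. all: end_near. Qed.

(** If g is C^k then so is its derivative v (jac f (g y))^-1, as a composition of
    g with a smooth function; thus g is C^(k+1). *)
Let g_Ck k : Ck k (f @` W) g.
Proof.
elim: k => [|k IH].
  by move=> y /(g_diff 0)[/differentiable_continuous].
split=> [y /(g_diff 0)[]//|v].
apply: (@Ck_eq _ _ _ _ _ (fun y => v *m invmx (jac f (g y)))) => //.
  by move=> y /(g_diff v)[].
apply/Ck_coordP => // j.
apply: (@Ck_comp _ _ _ _ _ W (fun z => (v *m invmx (jac f z)) 0 j) g) => //.
  by move=> y /gP[].
apply: Ck_local => z Wz.
have [_ sz _] := Hr Wz.
have : smooth_at (fun z => (v *m invmx (jac f z)) 0 j) z.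
  apply: (@smooth_at_eq _ _ _ (fun z => \sum_i v 0 i * invmx (jac f z) i j)).
    by near=> x; rewrite mxE.
  apply: smooth_at_sum => i; apply: smooth_atM; first exact: smooth_at_cst.
  apply: smooth_at_invmx; first exact: jac_unit.
  by move=> a b; exact: smooth_at_jac.
by move=> [V [oV Vz HV]]; exists V.
Unshelve. all: end_near. Qed.

Lemma inverse_on_ball : exists W g, [/\ open W, W x0, open (f @` W),
  forall x, W x -> P x /\ g (f x) = x & forall y, (f @` W) y -> smooth_at g y].
Proof.
exists W, g; split=> //.
- by rewrite /W /= subrr normr0.
- by move=> x Wx; split; [have [] := Hr Wx|exact: gK].
- by move=> y Wy; exists (f @` W); split=> // k; exact: g_Ck.
Qed.

End Radius.

Lemma inverse_function_id : exists W g, [/\ open W, W x0, open (f @` W),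
  forall x, W x -> P x /\ g (f x) = x & forall y, (f @` W) y -> smooth_at g y].
Proof. by have [r [r0 Hr]] := good_radius; exact: inverse_on_ball r0 Hr. Qed.

End InverseFunction.

(** The source and target dimensions m and p are equal here, but only through Q:
    keeping them apart spares casts between coordinate spaces.  The predicate P
    lets the neighbourhood be chosen inside any other one. *)
Lemma inverse_function (R : realType) m p (f : 'rV[R]_m -> 'rV[R]_p) x0
    (Q : 'M[R]_(p, m)) (P : 'rV[R]_m -> Prop) :
  smooth_at f x0 -> jac f x0 *m Q = 1%:M -> Q *m jac f x0 = 1%:M ->
  (\forall z \near x0, P z) ->
  exists W g, [/\ open W, W x0, open (f @` W),
    forall x, W x -> P x /\ g (f x) = x & forall y, (f @` W) y -> smooth_at g y].
Proof.
move=> sf JQ QJ nP; have df := smooth_at_differentiable sf.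
have QI (u : 'rV[R]_p) : (u *m Q) *m jac f x0 = u by rewrite -mulmxA QJ mulmx1.
(* Composing with Q makes the derivative at x0 the identity. *)
pose h z := f z *m Q.
have sh : smooth_at h x0 by exact: smooth_at_mulmxr.
have dh v : 'D_v h x0 = v.
  rewrite deriveE; last exact: smooth_at_differentiable.
  have dQ z : differentiable (mulmxr Q : 'rV[R]_p -> 'rV[R]_m) z.
    exact/linear_differentiable/linear_rV_continuous.
  rewrite -[h]/((mulmxr Q : 'rV[R]_p -> 'rV[R]_m) \o f) diff_comp //=.
  rewrite diff_lin; last exact: linear_rV_continuous.
  by rewrite /= -deriveE // (jacE _ df) -mulmxA JQ mulmx1.
have [W [g [oW Wx0 oh gh sg]]] := inverse_function_id sh dh nP.
have imE : f @` W = (fun y => y *m Q) @^-1` (h @` W).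
  apply/seteqP; split=> y /=.
    by move=> [x Wx <-]; exists x.
  move=> [x Wx hx]; exists x => //.
  by rewrite -[LHS]QI -/(h x) hx QI.
exists W, (fun y => g (y *m Q)); split=> //.
- rewrite imE; move/continuousP: (@linear_rV_continuous R p _ (mulmxr Q)); exact.
- move=> y Wy; apply: smooth_at_comp; first by apply: sg; move: Wy; rewrite imE.
  exact/smooth_at_mulmxr/smooth_at_id.
Qed.

(** * Smooth maps between manifolds given by atlases *)

Arguments cdim {R T} c.
Arguments cdom {R T} c.
Arguments cmap {R T} c x.
Arguments cinv {R T} c y.

Section SmoothInto.
Variables (R : realType) (T : Type).
Implicit Types (c : chart R T) (m : nat).

(** A map P into a manifold, near y, read in the chart c. *)
Definition smooth_into m c (P : 'rV[R]_m -> T) (y : 'rV[R]_m) : Prop :=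
  (\forall z \near y, cdom c (P z)) /\ smooth_at (fun z => cmap c (P z)) y.

Lemma smooth_into_dom m c (P : 'rV[R]_m -> T) y :
  smooth_into c P y -> cdom c (P y).
Proof. by case=> /nbhs_singleton. Qed.

Lemma smooth_into_eq m c (P Q : 'rV[R]_m -> T) y :
  (\forall z \near y, P z = Q z) -> smooth_into c P y -> smooth_into c Q y.
Proof.
move=> PQ [dP sP]; split; first by apply: filterS2 PQ dP => z ->.
by apply: smooth_at_eq sP; apply: filterS PQ => z ->.
Qed.

Lemma smooth_into_reparam m p c (P : 'rV[R]_p -> T) (h : 'rV[R]_m -> 'rV[R]_p) y :
  smooth_into c P (h y) -> smooth_at h y -> smooth_into c (fun z => P (h z)) y.
Proof.
move=> [dP sP] sh; split; last exact: (smooth_at_comp sP sh).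
exact: (smooth_at_continuous sh dP).
Qed.

Lemma cinvP c y : is_chart c -> (cmap c @` cdom c) y ->
  cdom c (cinv c y) /\ cmap c (cinv c y) = y.
Proof. by move=> [_ cK] [x dx <-]; rewrite cK. Qed.

Lemma cmap_inj c x x' : is_chart c -> cdom c x -> cdom c x' ->
  cmap c x = cmap c x' -> x = x'.
Proof. by move=> [_ cK] dx dx' e; rewrite -(cK x) // e cK. Qed.

Lemma near_image c x : is_chart c -> cdom c x ->
  \forall y \near cmap c x, (cmap c @` cdom c) y.
Proof. by move=> [oc _] dx; apply: open_near oc _; exists x. Qed.

Lemma smooth_into_cinv c x : is_chart c -> cdom c x ->
  smooth_into c (cinv c) (cmap c x).
Proof.
move=> cc dx; have H := near_image cc dx; split.
  by apply: filterS H => y /(cinvP cc)[].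
apply: smooth_at_eq (smooth_at_id _); apply: filterS H.
by move=> y /(cinvP cc)[].
Qed.

End SmoothInto.

Section SmoothBetween.
Variables (R : realType) (T T' : Type).

Lemma smooth_into_via m (f : T -> T') (c : chart R T) (c' : chart R T')
    (P : 'rV[R]_m -> T) y : is_chart c ->
  smooth_into c' (fun z => f (cinv c z)) (cmap c (P y)) -> smooth_into c P y ->
  smooth_into c' (fun z => f (P z)) y.
Proof.
move=> [_ cK] sf [dP sP].
apply: smooth_into_eq (smooth_into_reparam sf sP).
by apply: filterS dP => z /cK ->.
Qed.

(** The openness clause of [smooth_between] is automatic once f o c^-1 maps a
    neighbourhood of each point into the domain of c'. *)
Lemma smooth_betweenP (f : T -> T') (c : chart R T) (c' : chart R T') : is_chart c ->
  smooth_between f c c' <-> forall x, cdom c x -> cdom c' (f x) ->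
    smooth_into c' (fun z => f (cinv c z)) (cmap c x).
Proof.
move=> cc; have [oc cK] := cc.
split=> [[oV sV] x dx dfx|H].
  have Vx : (cmap c @` (cdom c `&` f @^-1` cdom c')) (cmap c x) by exists x.
  split; last by have /(smooth_onP _ oV) := sV; exact.
  by apply: filterS (open_near oV Vx) => _ [z [dz dfz] <-]; rewrite cK.
have oV : open (cmap c @` (cdom c `&` f @^-1` cdom c')).
  rewrite openE => _ [x [dx dfx] <-]; have [dP _] := H x dx dfx.
  rewrite /interior; apply: filterS2 (near_image cc dx) dP.
  by move=> z /(cinvP cc)[dz zE] dfz; exists (cinv c z).
split=> //; apply/smooth_onP => // _ [x [dx dfx] <-].
by have [_] := H x dx dfx.
Qed.

Lemma smooth_into_comp m (f : T -> T') (c : chart R T) (c' : chart R T')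
    (P : 'rV[R]_m -> T) y : is_chart c ->
  smooth_between f c c' -> smooth_into c P y -> cdom c' (f (P y)) ->
  smooth_into c' (fun z => f (P z)) y.
Proof.
move=> cc /(smooth_betweenP _ _ cc) sf sP dfP.
apply: smooth_into_via (sP) => //; apply: sf => //; exact: smooth_into_dom sP.
Qed.

End SmoothBetween.

Section Atlases.
Variables (R : realType) (T : Type).
Implicit Types (c : chart R T) (A : atlas R T).

Lemma smooth_into_chart m c c' (P : 'rV[R]_m -> T) y : is_chart c ->
  smooth_between id c c' -> smooth_into c P y -> cdom c' (P y) ->
  smooth_into c' P y.
Proof. by move=> cc sc sP dP; exact: (smooth_into_comp cc sc sP). Qed.

(** Two charts of the maximal atlas are compatible: near each point pass through
    a chart of the given atlas. *)
Lemma smooth_into_max A a b m (P : 'rV[R]_m -> T) y : smooth_atlas A ->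
  max_atlas A a -> max_atlas A b -> smooth_into a P y -> cdom b (P y) ->
  smooth_into b P y.
Proof.
move=> [Ac _] [ca aA Ha] [cb _ Hb] sP dP.
have [c Ac' dc] := aA _ (smooth_into_dom sP).
apply: (smooth_into_chart (c:=c)) => //; first exact: Ac.
  by have [] := Hb c Ac'.
by apply: smooth_into_chart sP _ => //; have [] := Ha c Ac'.
Qed.

Lemma max_atlas_sub A : smooth_atlas A -> A `<=` max_atlas A.
Proof.
move=> [Ac AA] c Ac'; split; [exact: Ac|by move=> x dx; exists c|].
by move=> c' Ac''; exact: AA.
Qed.

Lemma mopenP A U : smooth_atlas A -> U `<=` carrier A ->
  (forall c x, A c -> cdom c x -> U x -> \forall y \near cmap c x, U (cinv c y)) ->
  mopen A U.
Proof.
move=> [Ac _] UA H; split=> // c Ac'; have cc := Ac _ Ac'.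
rewrite openE => _ [x [dx Ux] <-]; rewrite /interior.
apply: filterS2 (near_image cc dx) (H c x Ac' dx Ux).
by move=> z /(cinvP cc)[dz zE] Uz; exists (cinv c z).
Qed.

Lemma mopen_near A U c m (P : 'rV[R]_m -> T) y : smooth_atlas A -> mopen A U ->
  A c -> smooth_into c P y -> U (P y) -> \forall z \near y, U (P z).
Proof.
move=> [Ac _] [_ oU] Ac' [dP sP] Uy; have [_ cK] := Ac _ Ac'.
have dPy := nbhs_singleton dP.
have : \forall z \near cmap c (P y), (cmap c @` (cdom c `&` U)) z.
  by apply: open_near; [exact: oU|exists (P y)].
move=> /(smooth_at_continuous sP) H.
apply: filterS2 dP H => z dz [x [dx Ux] xE].
by rewrite -(cK (P z)) // -xE cK.
Qed.

End Atlases.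

Lemma smooth_atlasP (R : realType) T (A : atlas R T) :
  (forall c, A c -> is_chart c) ->
  (forall c c' x, A c -> A c' -> cdom c x -> cdom c' x ->
     smooth_into c' (cinv c) (cmap c x)) ->
  smooth_atlas A.
Proof.
move=> Ac H; split=> // c c' Ac1 Ac2; split.
  by apply/smooth_betweenP => [|x]; [exact: Ac|exact: H].
by apply/smooth_betweenP => [|x]; [exact: Ac|exact: H].
Qed.

Lemma smooth_into_atlas (R : realType) T (A : atlas R T) c c' m
    (P : 'rV[R]_m -> T) y : smooth_atlas A -> A c -> A c' ->
  smooth_into c P y -> cdom c' (P y) -> smooth_into c' P y.
Proof.
move=> [Ac AA] Ac1 Ac2; apply: smooth_into_chart; first exact: Ac.
by have [] := AA _ _ Ac1 Ac2.
Qed.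

Lemma smooth_mapP (R : realType) T T' (A : atlas R T) (A' : atlas R T') f :
  smooth_atlas A ->
  (forall x, carrier A x -> carrier A' (f x)) ->
  (forall c c' x, A c -> A' c' -> cdom c x -> cdom c' (f x) ->
     smooth_into c' (fun z => f (cinv c z)) (cmap c x)) ->
  smooth_map A A' f.
Proof.
move=> [Ac _] cf H; split=> // c c' Ac1 Ac2.
by apply/smooth_betweenP => [|x]; [exact: Ac|exact: H].
Qed.

Lemma smooth_into_map (R : realType) T T' (A : atlas R T) (A' : atlas R T') f
    c c' m (P : 'rV[R]_m -> T) y : smooth_atlas A -> smooth_map A A' f ->
  A c -> A' c' -> smooth_into c P y -> cdom c' (f (P y)) ->
  smooth_into c' (fun z => f (P z)) y.
Proof.
move=> [Ac _] [_ sf] Ac1 Ac2 sP; apply: smooth_into_comp sP; first exact: Ac.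
exact: sf.
Qed.

Section OpenSubmanifold.
Variables (R : realType) (T : Type) (A : atlas R T) (W : set T).

Definition restrict_chart (c : chart R T) : chart R T :=
  Chart (cdom c `&` W) (cmap c) (cinv c).

Lemma smooth_into_restrict c m (P : 'rV[R]_m -> T) y :
  smooth_into (restrict_chart c) P y <->
  smooth_into c P y /\ \forall z \near y, W (P z).
Proof.
split=> [[/= dP sP]|[[dP sP] WP]].
  by do ?split=> //; apply: filterS dP => z [].
by split=> //; apply: filterS2 dP WP.
Qed.

Hypothesis sA : smooth_atlas A.
Hypothesis oW : mopen A W.

Lemma open_submanifold_smooth : smooth_atlas (open_submanifold A W).
Proof.
have [Ac AA] := sA.
apply: smooth_atlasP => [_ [c Ac1 <-]|_ _ x [c Ac1 <-] [c' Ac2 <-] /=].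
  split=> /=; first by have [_] := oW; exact.
  by move=> x [dx _]; have [_] := Ac c Ac1; exact.
move=> [dx Wx] [d'x _].
have cx := smooth_into_cinv (Ac _ Ac1) dx.
have cK : cinv c (cmap c x) = x by have [_] := Ac c Ac1; exact.
apply/smooth_into_restrict; split.
  by apply: (smooth_into_atlas sA Ac1 Ac2 cx); rewrite cK.
by apply: mopen_near sA oW Ac1 cx _; rewrite cK.
Qed.

Lemma carrier_open_submanifold x :
  carrier (open_submanifold A W) x <-> carrier A x /\ W x.
Proof.
split; first by move=> [_ [c Ac <-] [dx Wx]]; split=> //; exists c.
move=> [[c Ac dx] Wx]; exists (restrict_chart c); first by exists c.
by [].
Qed.

End OpenSubmanifold.

Section Submanifold.
Variables (R : realType) (T : Type) (A : atlas R T) (S : set T).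

Definition slice_chart k l (U : set T) (f : T -> 'rV[R]_(k + l))
    (g : 'rV[R]_(k + l) -> T) : chart R T :=
  Chart (U `&` S) (fun x => lsubmx (f x)) (fun y => g (row_mx y 0)).

(** The coordinates that a slice chart forgets vanish on S, so they can be put
    back. *)
Lemma smooth_into_slice k l U f g m (P : 'rV[R]_m -> T) y :
  (forall x, U x -> (S x <-> rsubmx (f x) = 0)) ->
  smooth_into (@slice_chart k l U f g) P y <->
  smooth_into (Chart U f g) P y /\ \forall z \near y, S (P z).
Proof.
move=> sl; split=> [[/= dP sP]|[[/= dP sP] SP]]; last first.
  by split; [apply: filterS2 dP SP|exact: smooth_at_lsubmx].
split; last by apply: filterS dP => z [].
split; first by apply: filterS dP => z [].
apply: smooth_at_eq (smooth_at_row_mx sP (smooth_at_cst (0 : 'rV[R]_l) y)).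
apply: filterS dP => z [Uz /(sl _ Uz) Sz] /=.
by rewrite -Sz hsubmxK.
Qed.

Hypothesis sA : smooth_atlas A.

Lemma slice_is_chart k l U f g :
  max_atlas A (Chart U f g) ->
  (forall x, U x -> (S x <-> rsubmx (f x) = 0)) ->
  is_chart (@slice_chart k l U f g).
Proof.
move=> [[/= oU gf] _ _] sl; split=> /=; last first.
  by move=> x [Ux /(sl _ Ux) Sx]; rewrite -[RHS](gf _ Ux) -[in RHS](hsubmxK (f x)) Sx.
have -> : (fun x => lsubmx (f x)) @` (U `&` S) =
  (fun y : 'rV[R]_k => row_mx y (0 : 'rV[R]_l)) @^-1` (f @` U).
  apply/seteqP; split=> y /=.
    move=> [x [Ux /(sl _ Ux) Sx] <-]; exists x => //.
    by rewrite -Sx hsubmxK.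
  move=> [x Ux fx]; exists x; last by rewrite fx row_mxKl.
  by split=> //; apply/sl; rewrite // fx row_mxKr.
apply: open_comp => // y _.
exact: (smooth_at_continuous (smooth_at_row_mx (smooth_at_id y) (smooth_at_cst (0 : 'rV[R]_l) y))).
Qed.

Lemma smooth_into_sub c' m (P : 'rV[R]_m -> T) y : sub_atlas A S c' ->
  smooth_into c' P y ->
  (\forall z \near y, S (P z)) /\
  forall a, max_atlas A a -> cdom a (P y) -> smooth_into a P y.
Proof.
move=> [k [l [U [f [g [mU sl ->]]]]]] /(smooth_into_slice _ _ _ sl)[sP SP].
by split=> // a ma; exact: (smooth_into_max sA mU ma).
Qed.

Lemma smooth_into_subI c' a m (P : 'rV[R]_m -> T) y : sub_atlas A S c' ->
  max_atlas A a -> smooth_into a P y -> (\forall z \near y, S (P z)) ->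
  cdom c' (P y) -> smooth_into c' P y.
Proof.
move=> [k [l [U [f [g [mU sl ->]]]]]] ma sP SP [Uy _].
by apply/(smooth_into_slice _ _ _ sl); split=> //; exact: (smooth_into_max sA ma mU).
Qed.

Lemma sub_atlas_is_chart c' : sub_atlas A S c' -> is_chart c'.
Proof.
by move=> [k [l [U [f [g [mU sl ->]]]]]]; exact: slice_is_chart.
Qed.

Lemma sub_atlas_dom c' x : sub_atlas A S c' -> cdom c' x -> S x /\ carrier A x.
Proof.
by move=> [k [l [U [f [g [[_ UA _] sl ->]]]]]] [Ux Sx]; split=> //; exact: UA.
Qed.

(** Slice charts are restrictions of charts of the maximal atlas. *)
Lemma sub_atlas_smooth : smooth_atlas (sub_atlas A S).
Proof.
apply: smooth_atlasP; first exact: sub_atlas_is_chart.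
move=> c c' x Sc Sc' dx d'x.
have cc := sub_atlas_is_chart Sc.
have [_ cK] := cc.
have [SP H] := smooth_into_sub Sc (smooth_into_cinv cc dx).
have [_ [a Aa da]] := sub_atlas_dom Sc dx.
have ma := max_atlas_sub sA Aa.
by apply: (smooth_into_subI Sc' ma (H a ma _)) => //; rewrite cK.
Qed.

Lemma sub_atlas_smooth_map T' (B : atlas R T') (f : T -> T') :
  smooth_map A B f -> smooth_map (sub_atlas A S) B f.
Proof.
move=> sf; apply: smooth_mapP; first exact: sub_atlas_smooth.
  move=> x [c Sc dx]; have [_ Ax] := sub_atlas_dom Sc dx.
  by have [+ _] := sf; exact.
move=> c b x Sc Bb dx db.
have cc := sub_atlas_is_chart Sc.
have [_ cK] := cc.
have [SP H] := smooth_into_sub Sc (smooth_into_cinv cc dx).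
have [_ [a Aa da]] := sub_atlas_dom Sc dx.
have ma := max_atlas_sub sA Aa.
apply: (smooth_into_map sA sf Aa Bb); last by rewrite cK.
by apply: H => //; rewrite cK.
Qed.

End Submanifold.

(** * Regular level sets *)

Section Straightening.
Variables (R : realType).

Lemma choose_rows m p q (M : 'M[R]_(m, p)) (C : 'rV[R]_m -> Prop) :
  (forall w : 'rV[R]_p, exists2 e : 'rV[R]_m, C e & e *m M = w) ->
  forall Z : 'M[R]_(q, p), exists2 N : 'M[R]_(q, m),
    N *m M = Z & forall i, C (row i N).
Proof.
move=> H Z; have /boolp.choice[e He] : forall i, exists e : 'rV[R]_m, C e /\ e *m M = row i Z.
  by move=> i; have [e Ce eM] := H (row i Z); exists e.
exists (\matrix_i e i); last by move=> i; rewrite rowK; have [] := He i.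
by apply/row_matrixP => i; rewrite row_mul rowK; have [] := He i.
Qed.

(** Let N be a right inverse of the surjection given by U and F together.  The
    complementary coordinates L are those of the projection 1 - M N onto the
    kernel of M = (U F), read in a basis K of this kernel. *)
Lemma complete_coordinates m d l (U : 'M[R]_(m, d)) (F : 'M[R]_(m, l)) :
  (forall w : 'rV[R]_d, exists e : 'rV[R]_m, e *m U = w) ->
  (forall z : 'rV[R]_l, exists e : 'rV[R]_m, e *m U = 0 /\ e *m F = z) ->
  exists k (L : 'M[R]_(m, k)) (Q : 'M[R]_(d + k + l, m)),
    row_mx (row_mx U L) F *m Q = 1%:M /\ Q *m row_mx (row_mx U L) F = 1%:M.
Proof.
move=> HU HF.
have [N0 N0U _] : exists2 N : 'M[R]_(d, m), N *m U = 1%:M & forall i : 'I_d, True.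
  by apply: (@choose_rows _ _ _ _ (fun=> True)) => w; have [e] := HU w; exists e.
have [NF NFF NFU'] : exists2 N : 'M[R]_(l, m), N *m F = 1%:M &
    forall i, row i N *m U = 0.
  apply: (@choose_rows _ _ _ _ (fun e => e *m U = 0)) => w.
  by have [e [eU eF]] := HF w; exists e.
have NFU : NF *m U = 0 by apply/row_matrixP => i; rewrite row_mul row0.
pose NU := N0 - N0 *m F *m NF.
have NUU : NU *m U = 1%:M by rewrite /NU mulmxBl -(mulmxA _ NF) NFU mulmx0 subr0.
have NUF : NU *m F = 0 by rewrite /NU mulmxBl -(mulmxA _ NF) NFF mulmx1 subrr.
pose M := row_mx U F.
pose E := 1%:M - (U *m NU + F *m NF).
have EM : E *m M = 0.
  have NUM : NU *m M = row_mx 1%:M 0 by rewrite mul_mx_row NUU NUF.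
  have NFM : NF *m M = row_mx 0 1%:M by rewrite mul_mx_row NFU NFF.
  rewrite mulmxBl mul1mx mulmxDl -!mulmxA NUM NFM !mul_mx_row.
  by rewrite !mulmx1 !mulmx0 add_row_mx addr0 add0r subrr.
(* E projects onto the kernel of M. *)
have /submxP[L EL] : (E <= row_base (kermx M))%MS.
  by rewrite eq_row_base; apply/sub_kermxP.
pose K := row_base (kermx M).
have KM : K *m M = 0 by apply/sub_kermxP; rewrite eq_row_base.
have [KU KF] : K *m U = 0 /\ K *m F = 0.
  by move: KM; rewrite mul_mx_row -[X in _ = X]row_mx0 => /eq_row_mx.
have freeK : row_free K by exact: row_base_free.
have KL : K *m L = 1%:M.
  apply: (row_free_inj freeK); rewrite /= mul1mx -mulmxA -EL mulmxBr mulmx1.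
  by rewrite mulmxDr !mulmxA KU KF !mul0mx addr0 subr0.
have NUL : NU *m L = 0.
  apply: (row_free_inj freeK); rewrite /= mul0mx -mulmxA -EL mulmxBr mulmx1.
  by rewrite mulmxDr !mulmxA NUU NUF mul0mx mul1mx addr0 subrr.
have NFL : NF *m L = 0.
  apply: (row_free_inj freeK); rewrite /= mul0mx -mulmxA -EL mulmxBr mulmx1.
  by rewrite mulmxDr !mulmxA NFU NFF mul0mx mul1mx add0r subrr.
exists _, L, (col_mx (col_mx NU K) NF); split.
  by rewrite !mul_row_col -EL /E addrAC addrC subrK.
rewrite !mul_col_row mul_col_mx mul_mx_row NUU NUL KU KL NUF KF NFU NFL NFF.
by rewrite -scalar_mx_block row_mx0 col_mx0 -scalar_mx_block.
Qed.

End Straightening.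

Lemma jac_row_mx (R : realType) m p q (f : 'rV[R]_m -> 'rV[R]_p)
    (g : 'rV[R]_m -> 'rV[R]_q) x : smooth_at f x -> smooth_at g x ->
  jac (fun z => row_mx (f z) (g z)) x = row_mx (jac f x) (jac g x).
Proof.
move=> sf sg; have df := smooth_at_differentiable (smooth_at_row_mx sf sg).
apply/matrixP => i j; rewrite mxE -derive_coord //.
case: (split_ordP j) => k ->.
  rewrite row_mxEl mxE -derive_coord; last exact: smooth_at_differentiable.
  by congr ('D__ _ _); apply/funext => z; rewrite row_mxEl.
rewrite row_mxEr mxE -derive_coord; last exact: smooth_at_differentiable.
by congr ('D__ _ _); apply/funext => z; rewrite row_mxEr.
Qed.

Lemma jac_mulmx (R : realType) m p (L : 'M[R]_(m, p)) x :
  jac (fun z : 'rV[R]_m => z *m L) x = L.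
Proof.
have cL : continuous (mulmxr L : 'rV[R]_m -> 'rV[R]_p) by exact: linear_rV_continuous.
have dL : differentiable (mulmxr L : 'rV[R]_m -> 'rV[R]_p) x.
  exact: linear_differentiable.
apply/matrixP => i j; rewrite mxE (deriveE _ dL).
by rewrite (diff_lin _ cL) /= -rowE mxE.
Qed.

Section RegularLevelSets.
Variables (R : realType) (T D : Type) (A : atlas R T) (B : atlas R D).
Variables (pi : T -> D) (S : set T).

(** The local equation at p: near p the set S is the zero set of F, and the
    differential of F is onto even on the vectors tangent to the fiber of pi. *)
Definition regular_at (p : T) : Prop :=
  exists (c : chart R T) (b : chart R D) l (F : 'rV[R]_(cdim c) -> 'rV[R]_l),
    let u := fun z => cmap b (pi (cinv c z)) in
    [/\ A c /\ cdom c p, B b /\ cdom b (pi p),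
        smooth_at F (cmap c p) /\
          (\forall z \near cmap c p, S (cinv c z) <-> F z = 0),
        forall w, exists e, 'D_e u (cmap c p) = w &
        forall z, exists e, 'D_e u (cmap c p) = 0 /\ 'D_e F (cmap c p) = z].

Hypotheses (sA : smooth_atlas A) (sB : smooth_atlas B).
Hypothesis (spi : smooth_map A B pi).

Section LocalDiffeo.
Variables (c : chart R T) (m : nat) (h : 'rV[R]_(cdim c) -> 'rV[R]_m).
Variables (W : set 'rV[R]_(cdim c)) (g : 'rV[R]_m -> 'rV[R]_(cdim c)).
Hypothesis Ac : A c.
Hypothesis oW : open W.
Hypothesis ohW : open (h @` W).
Hypothesis Wc : W `<=` cmap c @` cdom c.
Hypothesis hg : forall x, W x -> g (h x) = x.
Hypothesis sh : forall x, W x -> smooth_at h x.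
Hypothesis sg : forall y, (h @` W) y -> smooth_at g y.

(** The chart c followed by a local diffeomorphism h of coordinates, with
    inverse g. *)
Definition change_chart : chart R T :=
  Chart (cdom c `&` cmap c @^-1` W) (fun x => h (cmap c x))
        (fun y => cinv c (g y)).

Let cc : is_chart c. Proof. by have [+ _] := sA; exact. Qed.

Lemma change_chart_image : cmap change_chart @` cdom change_chart = h @` W.
Proof.
apply/seteqP; split=> y /=; first by move=> [x [dx Wx] <-]; exists (cmap c x).
move=> [x Wx <-]; have [dx xE] := cinvP cc (Wc Wx).
by exists (cinv c x); rewrite /= ?xE.
Qed.

Lemma change_chart_is_chart : is_chart change_chart.
Proof.
split; first by rewrite change_chart_image.
by move=> x [/= dx Wx]; rewrite hg //; have [_] := cc; exact.
Qed.

Lemma smooth_into_change m' (P : 'rV[R]_m' -> T) y :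
  smooth_into change_chart P y <-> smooth_into c P y /\ W (cmap c (P y)).
Proof.
split=> [[dP sP]|[[dP sP] WP]].
  have [_ /= Wy] := nbhs_singleton dP; split=> //.
  split; first by apply: filterS dP => z [].
  have hW : (h @` W) (h (cmap c (P y))) by exists (cmap c (P y)).
  apply: smooth_at_eq (smooth_at_comp (sg hW) sP).
  by apply: filterS dP => z [/= _ /hg].
split; last exact: smooth_at_comp (sh WP) sP.
have WzP := smooth_at_continuous sP (open_near oW WP).
by apply: filterS2 dP WzP.
Qed.

Lemma change_chart_max : max_atlas A change_chart.
Proof.
split; first exact: change_chart_is_chart.
  by move=> x [dx _]; exists c.
move=> c' Ac'; have [Ach _] := sA; split.
  apply/smooth_betweenP; first exact: change_chart_is_chart.
  move=> x dx d'x.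
  have [_ xK] := change_chart_is_chart.
  have /smooth_into_change[sx _] := smooth_into_cinv change_chart_is_chart dx.
  by apply: (smooth_into_atlas sA Ac Ac' sx); rewrite xK.
apply/smooth_betweenP; first exact: Ach.
move=> x d'x [dx Wx]; have [_ xK] := Ach _ Ac'.
have sx := smooth_into_cinv (Ach _ Ac') d'x.
apply/smooth_into_change; split; last by rewrite xK.
by apply: (smooth_into_atlas sA Ac' Ac sx); rewrite xK.
Qed.

End LocalDiffeo.

(** A slice chart at p: base coordinates u, complementary linear coordinates
    z L, and the equation F.  Freezing z L and setting F = 0 gives a smooth local
    section s of pi that passes through p and runs in S. *)
Lemma regular_slice p : S p -> regular_at p ->
  exists c', sub_atlas A S c' /\ cdom c' p /\
  exists b (s : 'rV[R]_(cdim b) -> T),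
    [/\ B b, cdom b (pi p), smooth_into c' s (cmap b (pi p)),
        s (cmap b (pi p)) = p &
        \forall u \near cmap b (pi p), cdom b (pi (s u)) /\ cmap b (pi (s u)) = u].
Proof.
move=> Sp [c [b [l [F [[Ac dp] [Bb db] [sF SF] HU HF]]]]].
have cc : is_chart c by have [+ _] := sA; exact.
have cK : cinv c (cmap c p) = p by have [_] := cc; exact.
pose x0 := cmap c p.
pose u z := cmap b (pi (cinv c z)).
have [du su] : smooth_into b (fun z => pi (cinv c z)) x0.
  by apply: (smooth_into_map sA spi Ac Bb (smooth_into_cinv cc dp)); rewrite cK.
have dfu := smooth_at_differentiable su.
have dfF := smooth_at_differentiable sF.
have [k [L [Q [QL LQ]]]] : exists k (L : 'M[R]_(cdim c, k))
    (Q : 'M[R]_(cdim b + k + l, cdim c)),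
    row_mx (row_mx (jac u x0) L) (jac F x0) *m Q = 1%:M /\
    Q *m row_mx (row_mx (jac u x0) L) (jac F x0) = 1%:M.
  apply: complete_coordinates => w.
    by have [e <-] := HU w; exists e; rewrite -jacE.
  by have [e [eu <-]] := HF w; exists e; rewrite -!jacE.
pose h z := row_mx (row_mx (u z) (z *m L)) (F z).
have sL z : smooth_at (fun z : 'rV[R]_(cdim c) => z *m L) z.
  exact/smooth_at_mulmxr/smooth_at_id.
have sh : smooth_at h x0 by apply: smooth_at_row_mx sF; exact: smooth_at_row_mx.
have jh : jac h x0 = row_mx (row_mx (jac u x0) L) (jac F x0).
  by rewrite !jac_row_mx ?jac_mulmx //; exact: smooth_at_row_mx.
pose P z := [/\ (cmap c @` cdom c) z, S (cinv c z) <-> F z = 0,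
  cdom b (pi (cinv c z)) & smooth_at h z].
have nP : \forall z \near x0, P z.
  near=> z; split; near: z => //; first exact: near_image.
  exact: smooth_at_near.
have [W [g [oW Wx0 ohW HW sg]]] := inverse_function sh
  (etrans (congr1 (mulmx^~ Q) jh) QL) (etrans (congr1 (mulmx Q) jh) LQ) nP.
have Wc : W `<=` cmap c @` cdom c by move=> z /HW[[]].
have hg z : W z -> g (h z) = z by move=> /HW[].
have shW z : W z -> smooth_at h z by move=> /HW[[]].
pose c1 := change_chart h W g.
have mc1 : max_atlas A c1 by exact: change_chart_max.
have sl x : cdom c1 x -> (S x <-> rsubmx (cmap c1 x) = 0).
  move=> [/= dx /HW[[_ HS _ _] _]]; rewrite row_mxKr -HS.
  by have [_ ->] := cc.
pose c' := slice_chart S (cdom c1) (cmap c1) (cinv c1).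
have Sc' : sub_atlas A S c'.
  exists (cdim b + k)%N, l, (cdom c1), (cmap c1), (cinv c1); split=> //.
exists c'; split=> //; split; first by split=> //; split.
have F0 : F x0 = 0 by apply/(nbhs_singleton SF); rewrite cK.
have u0 : u x0 = cmap b (pi p) by rewrite /u cK.
pose v (w : 'rV[R]_(cdim b)) := row_mx (row_mx w (x0 *m L)) (0 : 'rV[R]_l).
have v0 : v (cmap b (pi p)) = h x0 by rewrite /v /h F0 u0.
have hx0 : (h @` W) (h x0) by exists x0.
have sv w : smooth_at v w.
  apply: smooth_at_row_mx (smooth_at_cst _ _).
  exact: smooth_at_row_mx (smooth_at_id _) (smooth_at_cst _ _).
pose s w := cinv c1 (v w).
have nv : \forall w \near cmap b (pi p), (h @` W) (v w).
  have H := open_near ohW hx0; rewrite -v0 in H.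
  exact: (smooth_at_continuous (sv _) H).
have ns : \forall w \near cmap b (pi p), cdom c1 (s w) /\ cmap c1 (s w) = v w.
  apply: filterS nv => w; rewrite -(change_chart_image h g Ac Wc).
  apply: cinvP; exact: change_chart_is_chart.
have sK : s (cmap b (pi p)) = p by rewrite /s v0 /= hg.
exists b, s; split=> //.
  apply/(smooth_into_slice _ _ _ sl); split; last first.
    by apply: filterS ns => w [dw wE]; apply/sl; rewrite // wE row_mxKr.
  split; first by apply: filterS ns => w [].
  by apply: smooth_at_eq (sv _); apply: filterS ns => w [_ ->].
apply: filterS2 ns nv => w _ [z Wz zE].
have -> : s w = cinv c z by rewrite /s -zE /= hg.
have [[_ _ dz _] _] := HW z Wz; split=> //.
by move: zE; rewrite /v /h => /eq_row_mx[/eq_row_mx[]].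
Unshelve. all: end_near. Qed.

(** In arbitrary charts, pi read in coordinates has chi, the local section read
    in coordinates, as a right inverse; so its differential is onto. *)
Lemma regular_subfamily : mclosed A S -> (forall p, S p -> regular_at p) ->
  is_subfamily A B pi S.
Proof.
move=> clS rS; have [SA _] := clS.
have sS := sub_atlas_smooth S sA.
have sSpi := sub_atlas_smooth_map S sA spi.
split=> //.
  split=> // p Sp; have [c' [Sc' [dc' _]]] := regular_slice Sp (rS p Sp).
  by exists c'.
split=> // c1 b1 p Sc1 Bb1 dp dbp.
have [Sp Ap] := sub_atlas_dom Sc1 dp.
have [c' [Sc' [dc' [b [s [Bb db ss sE ns]]]]]] := regular_slice Sp (rS p Sp).
have ss1 : smooth_into c1 s (cmap b (pi p)).
  by apply: (smooth_into_atlas sS Sc' Sc1 ss); rewrite sE.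
have bb : is_chart b by have [+ _] := sB; exact.
have bb1 : is_chart b1 by have [+ _] := sB; exact.
have bK : cinv b1 (cmap b1 (pi p)) = pi p by have [_] := bb1; exact.
have c1c := sub_atlas_is_chart Sc1.
have c1K : cinv c1 (cmap c1 p) = p by have [_] := c1c; exact.
pose psi := cmap b1 \o pi \o cinv c1.
have [dpsi spsi] : smooth_into b1 (fun z => pi (cinv c1 z)) (cmap c1 p).
  by apply: (smooth_into_map sS sSpi Sc1 Bb1 (smooth_into_cinv c1c dp)); rewrite c1K.
have [dth sth] : smooth_into b (cinv b1) (cmap b1 (pi p)).
  by apply: (smooth_into_atlas sB Bb1 Bb (smooth_into_cinv bb1 dbp)); rewrite bK.
pose th w := cmap b (cinv b1 w).
have th0 : th (cmap b1 (pi p)) = cmap b (pi p) by rewrite /th bK.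
pose chi w := cmap c1 (s (th w)).
have [dchi schi] : smooth_into c1 (fun w => s (th w)) (cmap b1 (pi p)).
  by apply: smooth_into_reparam sth; rewrite -/(th _) th0.
have chi0 : chi (cmap b1 (pi p)) = cmap c1 p by rewrite /chi th0 sE.
have dfpsi : differentiable psi (cmap c1 p) by exact: smooth_at_differentiable spsi.
have dfchi := smooth_at_differentiable schi.
have nid : \forall w \near cmap b1 (pi p), w = (psi \o chi) w.
  have nth : \forall w \near cmap b1 (pi p),
      cdom b (pi (s (th w))) /\ cmap b (pi (s (th w))) = th w.
    rewrite -th0 in ns; exact: (smooth_at_continuous sth ns).
  near=> w.
  have dw : cdom c1 (s (th w)) by near: w.
  have [d1 e1] : cdom b (pi (s (th w))) /\ cmap b (pi (s (th w))) = th w by near: w.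
  have [d2 e2] : cdom b1 (cinv b1 w) /\ cmap b1 (cinv b1 w) = w.
    by apply: (cinvP bb1); near: w; exact: near_image.
  have d3 : cdom b (cinv b1 w) by near: w.
  have piE : pi (s (th w)) = cinv b1 w by exact: (cmap_inj bb d1 d3 e1).
  rewrite /psi /chi /=; have [_ ->] := c1c; last by [].
  by rewrite piE e2.
apply/seteqP; split=> // w _; exists ('D_w chi (cmap b1 (pi p))) => //.
rewrite -deriveE //.
have := near_eq_derive w nid.
rewrite -[X in 'D_w X _ = _]/(id) derive_id derive_compE // -?chi0 //.
by rewrite chi0.
Unshelve. all: end_near. Qed.

End RegularLevelSets.

(** * Smooth sections of a bundle of algebras *)

Arguments tmap {R D E} t {x} e.
Arguments tinv {R D E} t x v.
Arguments trank {R D E} t.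
Arguments tdom {R D E} t.
Arguments tot_chart {R D E} c t.
Arguments mx_triv {R D} n {E} t.
Arguments tot_atlas {R D E} B T.
Arguments pair_triv {R D E} t.

Section TotalCharts.
Variables (R : realType) (D : Type) (B : atlas R D) (sB : smooth_atlas B).
Variables (E : D -> Type).

(** A map into the total space is a map into the base together with its vector
    coordinates. *)
Lemma smooth_into_totP (c : chart R D) (t : triv R E) m
    (P : 'rV[R]_m -> tot E) y :
  smooth_into (tot_chart c t) P y <->
  [/\ smooth_into c (fun z => projT1 (P z)) y,
      \forall z \near y, tdom t (projT1 (P z)) &
      smooth_at (fun z => tmap t (projT2 (P z))) y].
Proof.
split=> [[dP sP]|[[dP sP] tP sT]].
  split; last 2 first.
  - by apply: filterS dP => z [].
  - apply: smooth_at_eq (smooth_at_rsubmx sP).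
    by near=> z; rewrite row_mxKr.
  split; first by apply: filterS dP => z [].
  apply: smooth_at_eq (smooth_at_lsubmx sP).
  by near=> z; rewrite row_mxKl.
by split; [apply: filterS2 dP tP => z|exact: smooth_at_row_mx].
Unshelve. all: end_near. Qed.

Lemma tot_chart_is_chart (c : chart R D) (t : triv R E) : B c ->
  mopen B (tdom t) ->
  (forall x, tdom t x -> cancel (@tmap R D E t x) (tinv t x)) ->
  (forall x, tdom t x -> cancel (tinv t x) (@tmap R D E t x)) ->
  is_chart (tot_chart c t).
Proof.
move=> Bc [_ ot] K K'; have [cB _] := sB; have [oc cK] := cB _ Bc.
split=> /=; last first.
  by move=> [x e] [/= dx tx]; rewrite row_mxKl row_mxKr cK // K.
have -> : (fun p : tot E => row_mx (cmap c (projT1 p)) (tmap t (projT2 p))) @`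
    [set p | cdom c (projT1 p) /\ tdom t (projT1 p)] =
    (lsubmx : 'rV[R]_(cdim c + trank t) -> _) @^-1` (cmap c @` (cdom c `&` tdom t)).
  apply/seteqP; split=> v /=.
    by move=> [[x e] /= [dx tx] <-]; exists x; rewrite // row_mxKl.
  move=> [x [dx tx] xE]; exists (existT E x (tinv t x (rsubmx v))) => //=.
  by rewrite xE K' // hsubmxK.
apply: open_comp; last exact: ot.
by move=> v _; apply: smooth_at_continuous; exact/smooth_at_lsubmx/smooth_at_id.
Qed.

End TotalCharts.

Section AlgebraSections.
Variables (R : realType) (D : Type) (B : atlas R D) (A : D -> pzAlgType R).
Variables (T : set (triv R (fun x => A x))) (hA : is_algebra_family B T).

Lemma base_smooth : smooth_atlas B.
Proof. by have [[]] := hA. Qed.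

Lemma base_is_chart c : B c -> is_chart c.
Proof. by have [+ _] := base_smooth; exact. Qed.

Section Triv.
Variables (t : triv R (fun x => A x)) (Tt : T t).

Let tP : is_triv (E := fun x => alg_module (A x)) B t.
Proof. by have [_ _ [+ _ _] _ _] := hA; exact. Qed.

Lemma triv_open : mopen B (tdom t). Proof. by have [] := tP. Qed.

Lemma tmapK x : tdom t x -> cancel (@tmap R D _ t x) (tinv t x).
Proof. by have [_ H] := tP; move=> /H[]. Qed.

Lemma tinvK x : tdom t x -> cancel (tinv t x) (@tmap R D _ t x).
Proof. by have [_ H] := tP; move=> /H[]. Qed.

Lemma tmapZD x k (a b : A x) : tdom t x ->
  tmap t (ascale k a + b) = k *: tmap t a + tmap t b.
Proof. by have [_ H] := tP; move=> /H[+ _ _]; exact. Qed.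

Lemma tmapD x (a b : A x) : tdom t x -> tmap t (a + b) = tmap t a + tmap t b.
Proof. by move=> tx; have := tmapZD 1 a b tx; rewrite ascale1 scale1r. Qed.

Lemma tmap0 x : tdom t x -> tmap t (0 : A x) = 0.
Proof. by move=> tx; apply: (addIr (tmap t (0 : A x))); rewrite -tmapD // !add0r. Qed.

Lemma tmapZ x k (a : A x) : tdom t x -> tmap t (ascale k a) = k *: tmap t a.
Proof.
by move=> tx; have := tmapZD k a 0 tx; rewrite addr0 tmap0 // addr0.
Qed.

Lemma tmapN x (a : A x) : tdom t x -> tmap t (- a) = - tmap t a.
Proof.
by move=> tx; apply: (addIr (tmap t a)); rewrite -tmapD // !addNr tmap0.
Qed.

Lemma tmap_inj x (a b : A x) : tdom t x -> tmap t a = tmap t b -> a = b.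
Proof. by move=> tx /(congr1 (tinv t x)); rewrite !tmapK. Qed.

Variables (c : chart R D) (Bc : B c).

Lemma tot_algebra_chart : is_chart (tot_chart c t).
Proof.
apply: (tot_chart_is_chart base_smooth Bc) => //; first exact: triv_open.
  exact: tmapK.
exact: tinvK.
Qed.

Lemma tot_algebra_in : tot_atlas B T (tot_chart c t).
Proof. by exists c => //; exists t. Qed.

Section Sections.
Variables (m : nat) (beta : 'rV[R]_m -> D) (y : 'rV[R]_m).
Hypothesis sbeta : smooth_into c beta y.
Hypothesis tbeta : \forall z \near y, tdom t (beta z).
Implicit Types (s : forall z, A (beta z)).

(** Smoothness, read in the trivialization t, of a section along beta. *)
Definition smooth_section s := smooth_at (fun z => tmap t (s z)) y.

Lemma smooth_sectionE s :
  smooth_section s <-> smooth_into (tot_chart c t) (fun z => existT A (beta z) (s z)) y.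
Proof.
by split=> [ss|/smooth_into_totP[]//]; apply/smooth_into_totP.
Qed.

Lemma smooth_section_eq s s' : (\forall z \near y, s z = s' z) ->
  smooth_section s -> smooth_section s'.
Proof. by move=> H; apply: smooth_at_eq; apply: filterS H => z ->. Qed.

Lemma smooth_sectionD s s' : smooth_section s -> smooth_section s' ->
  smooth_section (fun z => s z + s' z).
Proof.
move=> ss ss'; apply: smooth_at_eq (smooth_atD ss ss').
by apply: filterS tbeta => z tz; rewrite tmapD.
Qed.

Lemma smooth_sectionZ (k : 'rV[R]_m -> R) s : smooth_at k y -> smooth_section s ->
  smooth_section (fun z => ascale (k z) (s z)).
Proof.
move=> sk ss; apply: (@smooth_at_eq _ _ _ (fun z => k z *: tmap t (s z))).
  by apply: filterS tbeta => z tz; rewrite tmapZ.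
apply/smooth_at_coordP => j.
apply: (@smooth_at_eq _ _ _ (fun z => k z * tmap t (s z) 0 j)).
  by near=> z; rewrite mxE.
by apply: smooth_atM => //; have /smooth_at_coordP := ss; exact.
Unshelve. all: end_near. Qed.

Lemma smooth_sectionN s : smooth_section s -> smooth_section (fun z => - s z).
Proof.
move=> ss; apply: smooth_section_eq (smooth_sectionZ (smooth_at_cst (-1 : R) y) ss).
apply: filterS tbeta => z tz; apply: (tmap_inj tz).
by rewrite tmapZ // tmapN // scaleN1r.
Qed.

Lemma smooth_section0 : smooth_section (fun z => 0).
Proof.
apply: smooth_at_eq (smooth_at_cst 0 y).
by apply: filterS tbeta => z tz; rewrite tmap0.
Qed.

Lemma smooth_section1 : smooth_section (fun z => 1).
Proof.
have [_ _ _ _ s1] := hA.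
have ty := nbhs_singleton tbeta.
have dy := smooth_into_dom sbeta.
have := smooth_into_map base_smooth s1 Bc tot_algebra_in sbeta (conj dy ty).
by move=> /smooth_sectionE.
Qed.

(** The pair (s, s') is smooth in the chart of the fiber product, and the
    multiplication is smooth between the charts given by the same c and t. *)
Lemma smooth_sectionM s s' : smooth_section s -> smooth_section s' ->
  smooth_section (fun z => s z * s' z).
Proof.
move=> ss ss'; have [_ _ _ [_ sM] _] := hA.
have ty := nbhs_singleton tbeta.
have dy := smooth_into_dom sbeta.
have cp : is_chart (tot_chart c (pair_triv t)).
  apply: (tot_chart_is_chart base_smooth Bc); first exact: triv_open.
    by move=> x tx [a b] /=; rewrite row_mxKl row_mxKr !tmapK.
  by move=> x tx v /=; rewrite !tinvK // hsubmxK.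
have sp : smooth_into (tot_chart c (pair_triv t))
    (fun z => existT (fun x => A x * A x)%type (beta z) (s z, s' z)) y.
  by apply/smooth_into_totP; split=> //=; exact: smooth_at_row_mx.
have sb : smooth_between (fun p : tot (fun x => A x * A x)%type =>
    existT A (projT1 p) ((projT2 p).1 * (projT2 p).2))
    (tot_chart c (pair_triv t)) (tot_chart c t).
  apply: sM; last exact: tot_algebra_in.
  by exists c => //; exists (pair_triv t) => //; exists t.
exact/smooth_sectionE/(smooth_into_comp cp sb sp).
Qed.

Lemma smooth_section_sum (I : Type) (r : seq I) (P : pred I)
    (s : I -> forall z, A (beta z)) : (forall i, smooth_section (s i)) ->
  smooth_section (fun z => \sum_(i <- r | P i) s i z).
Proof.
move=> Hf; elim: r => [|i r IH].
  by apply: smooth_section_eq smooth_section0; near=> z; rewrite big_nil.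
case: (boolP (P i)) => Pi.
  by apply: smooth_section_eq (smooth_sectionD (Hf i) IH); near=> z;
    rewrite big_cons Pi.
by apply: smooth_section_eq IH; near=> z; rewrite big_cons (negbTE Pi).
Unshelve. all: end_near. Qed.

Lemma smooth_section_prod (I : Type) (r : seq I) (P : pred I)
    (s : I -> forall z, A (beta z)) : (forall i, smooth_section (s i)) ->
  smooth_section (fun z => \prod_(i <- r | P i) s i z).
Proof.
move=> Hf; elim: r => [|i r IH].
  by apply: smooth_section_eq smooth_section1; near=> z; rewrite big_nil.
case: (boolP (P i)) => Pi.
  by apply: smooth_section_eq (smooth_sectionM (Hf i) IH); near=> z;
    rewrite big_cons Pi.
by apply: smooth_section_eq IH; near=> z; rewrite big_cons (negbTE Pi).
Unshelve. all: end_near. Qed.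

Lemma smooth_sectionX s k : smooth_section s -> smooth_section (fun z => s z ^+ k).
Proof.
move=> ss; elim: k => [|k IH]; first exact: smooth_section1.
by apply: smooth_section_eq (smooth_sectionM ss IH); near=> z; rewrite exprS.
Unshelve. all: end_near. Qed.

Lemma smooth_section_sigma (sigma : forall x, A x -> A x) s :
  is_involution B T sigma -> smooth_section s ->
  smooth_section (fun z => sigma _ (s z)).
Proof.
move=> [[_ ssig] _ _ _ _] /smooth_sectionE ss.
have ty := nbhs_singleton tbeta.
have dy := smooth_into_dom sbeta.
have sb := ssig _ _ tot_algebra_in tot_algebra_in.
exact/smooth_sectionE/(smooth_into_comp tot_algebra_chart sb ss).
Qed.

Section MatrixSections.
Variable n : nat.
Implicit Types X Y : forall z, 'M[A (beta z)]_n.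

Definition smooth_mx X := forall i j, smooth_section (fun z => X z i j).

Lemma smooth_mxM X Y : smooth_mx X -> smooth_mx Y ->
  smooth_mx (fun z => X z *m Y z).
Proof.
move=> sX sY i j.
apply: (@smooth_section_eq (fun z => \sum_k X z i k * Y z k j)).
  by near=> z; rewrite mxE.
by apply: smooth_section_sum => k; exact: smooth_sectionM.
Unshelve. all: end_near. Qed.

Lemma smooth_mxB X Y : smooth_mx X -> smooth_mx Y ->
  smooth_mx (fun z => X z - Y z).
Proof.
move=> sX sY i j.
apply: smooth_section_eq (smooth_sectionD (sX i j) (smooth_sectionN (sY i j))).
by near=> z; rewrite !mxE.
Unshelve. all: end_near. Qed.

Lemma smooth_mx_adjoint (sigma : forall x, A x -> A x) X :
  is_involution B T sigma -> smooth_mx X ->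
  smooth_mx (fun z => adjoint sigma (X z)).
Proof.
move=> hs sX i j.
apply: smooth_section_eq (smooth_section_sigma hs (sX j i)).
by near=> z; rewrite !mxE.
Unshelve. all: end_near. Qed.

Lemma smooth_mx_scalar s : smooth_section s -> smooth_mx (fun z => (s z)%:M).
Proof.
move=> ss i j; case: (eqVneq i j) => [->|ij].
  by apply: smooth_section_eq ss; near=> z; rewrite mxE eqxx.
by apply: smooth_section_eq smooth_section0; near=> z; rewrite mxE (negbTE ij).
Unshelve. all: end_near. Qed.

Lemma smooth_section_det X : smooth_mx X -> smooth_section (fun z => \det (X z)).
Proof.
move=> sX; apply: smooth_section_sum => s; apply: smooth_sectionM.
  by apply: smooth_sectionX; exact/smooth_sectionN/smooth_section1.
by apply: smooth_section_prod => i; exact: sX.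
Qed.

End MatrixSections.

End Sections.

Lemma mx_tmapE n x (X : 'M[A x]_n) i j l :
  tmap (mx_triv n t) X 0 (mxvec_index (mxvec_index i j) l) = tmap t (X i j) 0 l.
Proof. by rewrite /= mxvecE mxE mxvecE. Qed.

Lemma mx_tmapK n x : tdom t x ->
  cancel (@tmap R D _ (mx_triv n t) x) (tinv (mx_triv n t) x).
Proof.
move=> tx X /=; apply/matrixP => i j.
by rewrite mxE mxE mxvecK rowK tmapK // mxvecE.
Qed.

Lemma mx_tinvK n x : tdom t x ->
  cancel (tinv (mx_triv n t) x) (@tmap R D _ (mx_triv n t) x).
Proof.
move=> tx v /=; apply: (canLR vec_mxK); apply/row_matrixP => i.
by rewrite rowK vec_mxK mxE tinvK.
Qed.

Lemma mx_chart n : is_chart (tot_chart c (mx_triv n t)).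
Proof.
apply: (tot_chart_is_chart base_smooth Bc); first exact: triv_open.
  by move=> x tx; exact: mx_tmapK.
by move=> x tx; exact: mx_tinvK.
Qed.

Lemma smooth_mxE n m (beta : 'rV[R]_m -> D) (X : forall z, 'M[A (beta z)]_n) y :
  smooth_at (fun z => tmap (mx_triv n t) (X z)) y <-> smooth_mx y X.
Proof.
split=> [sX i j|sX].
  apply/smooth_at_coordP => l; move/smooth_at_coordP: sX.
  move=> /(_ (mxvec_index (mxvec_index i j) l)); apply: smooth_at_eq.
  by near=> z; rewrite mx_tmapE.
apply/smooth_at_coordP => q; case/mxvec_indexP: q => p l.
case/mxvec_indexP: p => i j.
have /smooth_at_coordP/(_ l) := sX i j; apply: smooth_at_eq.
by near=> z; rewrite mx_tmapE.
Unshelve. all: end_near. Qed.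

Lemma smooth_into_mxP n m (P : 'rV[R]_m -> tot (mxfam A n)) y :
  smooth_into (tot_chart c (mx_triv n t)) P y <->
  [/\ smooth_into c (fun z => projT1 (P z)) y,
      \forall z \near y, tdom t (projT1 (P z)) &
      smooth_mx (beta := fun z => projT1 (P z)) y (fun z => projT2 (P z))].
Proof.
by split=> [/smooth_into_totP[? ? ?]|[? ? ?]]; [split=> //|apply/smooth_into_totP; split=> //];
 exact/smooth_mxE.
Qed.

End Triv.

(** Transition maps act entry by entry, and those of the bundle of algebras are
    smooth. *)
Lemma mx_atlas_smooth n : smooth_atlas (mx_atlas B T n).
Proof.
apply: smooth_atlasP => [_ [c Bc [_ [t Tt <-] <-]]|]; first exact: mx_chart.
move=> _ _ x [c Bc [_ [t Tt <-] <-]] [c' Bc' [_ [t' Tt' <-] <-]] dx d'x.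
have cc := mx_chart Tt Bc n.
have [_ cK] := cc.
have /smooth_into_mxP[sb tb sX] := smooth_into_cinv cc dx.
have [/= dx1 tx1] := dx; have [/= d'x1 t'x1] := d'x.
have cx : projT1 (cinv (tot_chart c (mx_triv n t)) (cmap (tot_chart c (mx_triv n t)) x)) = projT1 x.
  by rewrite cK.
have [_ _ [_ _ st] _ _] := hA.
have sb' : smooth_into c' (fun z => projT1 (cinv (tot_chart c (mx_triv n t)) z))
    (cmap (tot_chart c (mx_triv n t)) x).
  by apply: (smooth_into_atlas base_smooth Bc Bc' sb); rewrite cx.
apply/smooth_into_mxP; split=> //.
  by apply: (mopen_near base_smooth (triv_open Tt') Bc sb); rewrite cx.
move=> i j; have /(smooth_sectionE sb tb) s1 := sX i j.
have := smooth_into_atlas st (tot_algebra_in Tt Bc) (tot_algebra_in Tt' Bc') s1.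
rewrite /= row_mxKl; have [_ -> //] := base_is_chart Bc.
by move=> /(_ (conj d'x1 t'x1)) /smooth_into_totP[].
Qed.

End AlgebraSections.

(** * Equations in the fixed bundle of an involution *)

Section InvolutiveEquations.
Variable R : realType.

(** P is the projection onto the fixed space of rho.  Its two rank factors give
    coordinates on that space, and P P = P makes them mutually inverse. *)
Lemma involution_half N (rho : 'M[R]_N) : rho *m rho = 1%:M ->
  let P := 2^-1 *: (1%:M + rho) in
  row_base P *m col_base P = 1%:M /\ row_base P *m rho = row_base P.
Proof.
move=> rr P.
have P2 : P *m P = P.
  rewrite /P -scalemxAl -scalemxAr scalerA mulmxDl mul1mx mulmxDr mulmx1 rr.
  rewrite [X in _ *: (_ + X)]addrC -mulr2n -[X in _ *: X]scaler_nat scalerA.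
  by congr (_ *: _); field.
have Pr : P *m rho = P.
  by rewrite /P -scalemxAl mulmxDl mul1mx rr addrC.
have cb := mulmx_base P.
have rf : row_free (row_base P) by exact: row_base_free.
have cf : row_full (col_base P) by exact: col_base_full.
split.
  apply: (row_full_inj cf); apply: (row_free_inj rf) => /=.
  by rewrite mulmx1 mulmxA -mulmxA !cb P2.
apply: (row_full_inj cf) => /=.
by rewrite mulmxA cb Pr.
Qed.

Lemma det2_neq0 N : \det (2%:M : 'M[R]_N) != 0.
Proof. by rewrite det_scalar expf_neq0 // pnatr_eq0. Qed.

(** Phi takes values in the fixed spaces of the involutions rho z.  If the
    projection of Phi z to the fixed space of rho y vanishes, then
    Phi z rho y = - Phi z, whence Phi z (2 - (rho z - rho y)) = 0; for z near y
    this matrix is invertible. *)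
Lemma involutive_equation m N (Phi : 'rV[R]_m -> 'rV[R]_N)
    (rho : 'rV[R]_m -> 'M[R]_N) y :
  (forall i j, smooth_at (fun z => rho z i j : R) y) ->
  rho y *m rho y = 1%:M ->
  (\forall z \near y, Phi z *m rho z = Phi z) ->
  exists l (Q : 'M[R]_(N, l)) (Q' : 'M[R]_(l, N)),
    [/\ \forall z \near y, Phi z *m Q = 0 <-> Phi z = 0,
        Q' *m Q = 1%:M & Q' *m rho y = Q'].
Proof.
move=> srho rr nPhi.
pose P := 2^-1 *: (1%:M + rho y).
have [RC Rrho] := involution_half rr.
exists (\rank P), (col_base P), (row_base P); split=> //.
have sM i j : smooth_at (fun z => (2%:M - (rho z - rho y)) i j : R) y.
  apply: (@smooth_at_eq _ _ _ (fun z => (2%:M + rho y) i j + (-1) * rho z i j)).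
    by near=> z; rewrite !mxE; ring.
  apply: smooth_atD; first exact: smooth_at_cst.
  by apply: smooth_atM => //; exact: smooth_at_cst.
have d0 : \det (2%:M - (rho y - rho y)) != 0 by rewrite subrr subr0 det2_neq0.
have nd := continuous_neq0 (smooth_at_continuous (smooth_at_det sM)) d0.
near=> z; split=> [PQ|->]; last by rewrite mul0mx.
have Pz : Phi z *m rho z = Phi z by near: z.
have PP : Phi z *m P = 0 by rewrite -(mulmx_base P) mulmxA PQ mul0mx.
have Pry : Phi z *m rho y = - Phi z.
  apply/eqP; rewrite -addr_eq0 addrC; apply/eqP.
  have : Phi z *m P = 2^-1 *: (Phi z + Phi z *m rho y).
    by rewrite /P -scalemxAr mulmxDr mulmx1.
  rewrite PP => /esym/eqP; rewrite scaler_eq0 invr_eq0 pnatr_eq0 /= => /eqP.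
  by [].
have uM : 2%:M - (rho z - rho y) \in unitmx.
  by rewrite unitmxE unitfE; near: z.
apply: (row_free_inj (A := 2%:M - (rho z - rho y))).
  by rewrite row_free_unit.
rewrite /= mul0mx mulmxBr mulmxBr Pz Pry mul_mx_scalar scaler_nat mulr2n opprK.
by rewrite subrr.
Unshelve. all: end_near. Qed.

Lemma linear_mxE p q (f : 'rV[R]_p -> 'rV[R]_q) : linear f ->
  forall v, f v = v *m \matrix_i f (delta_mx 0 i).
Proof.
move=> lf v.
pose fM := GRing.isLinear.Build _ _ _ _ _ lf.
pose fL : {linear 'rV[R]_p -> 'rV[R]_q} := HB.pack f fM.
rewrite -[f]/(fL : _ -> _) {1}(row_sum_delta v) linear_sum mulmx_sum_row.
by apply: eq_bigr => i _; rewrite linearZ rowK.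
Qed.

Lemma continuous_vec_neq0 m N (F : 'rV[R]_m -> 'rV[R]_N) y : smooth_at F y ->
  F y <> 0 -> \forall z \near y, F z <> 0.
Proof.
move=> sF F0.
have [j Fj] : exists j, F y 0 j != 0.
  apply: contrapT => H; apply: F0; apply/rowP => j; rewrite mxE.
  by apply/eqP/negP => /negP Fj; apply: H; exists j.
have /smooth_at_coordP/(_ j)/smooth_at_continuous cj := sF.
by apply: filterS (continuous_neq0 cj Fj) => z /eqP Fz F0'; apply: Fz; rewrite F0' mxE.
Qed.

Lemma derive_quadratic m N (F : 'rV[R]_m -> 'rV[R]_N) y e a b :
  (forall s : R, F (y + s *: e) = s *: a + s ^+ 2 *: b) -> 'D_e F y = a.
Proof.
move=> H.
have F0 : F y = 0 by have := H 0; rewrite scale0r addr0 expr0n /= !scale0r addr0.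
rewrite /derive; apply: cvg_lim => //.
apply: (@cvg_trans _ ((fun s : R => a + s *: b) @ (0 : R)^')).
  apply: (near_eq_cvg (F := (0:R)^')); near=> s.
  have s0 : s != 0 by near: s; exact: nbhs_dnbhs_neq.
  rewrite /= [s *: e + y]addrC H F0 subr0 scalerDr !scalerA mulVf // scale1r.
  by rewrite expr2 mulrA mulVf // mul1r.
have -> : nbhs a = nbhs (a + (0 : R) *: b) by rewrite scale0r addr0.
apply: cvgD; first exact: cvg_cst.
apply: cvgZr_tmp; exact: (@nbhs_dnbhs _ (0 : R)).
Unshelve. all: end_near. Qed.

End InvolutiveEquations.

Section MatrixFibers.
Variables (R : realType) (K : pzAlgType R) (n : nat).
Implicit Types (X Y : 'M[K]_n).

Lemma ascale0r (k : R) : ascale k (0 : K) = 0.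
Proof. by apply: (addIr (ascale k (0 : K))); rewrite -ascaleDr !add0r. Qed.

Lemma ascaleN (k : R) (a : K) : ascale k (- a) = - ascale k a.
Proof. by apply: (addIr (ascale k a)); rewrite -ascaleDr !addNr ascale0r. Qed.

Definition mxscale (k : R) X : 'M[K]_n := map_mx (ascale k) X.

Lemma ascale_sum k (I : Type) (r : seq I) (P : pred I) (F : I -> K) :
  ascale k (\sum_(i <- r | P i) F i) = \sum_(i <- r | P i) ascale k (F i).
Proof.
by apply: (big_morph (ascale k)); [exact: ascaleDr|exact: ascale0r].
Qed.

Lemma mxscaleAl k X Y : mxscale k (X *m Y) = mxscale k X *m Y.
Proof.
apply/matrixP => i j; rewrite !mxE ascale_sum; apply: eq_bigr => l _.
by rewrite mxE ascaleAl.
Qed.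

Lemma mxscaleAr k X Y : mxscale k (X *m Y) = X *m mxscale k Y.
Proof.
apply/matrixP => i j; rewrite !mxE ascale_sum; apply: eq_bigr => l _.
by rewrite mxE ascaleAr.
Qed.

Lemma mxscaleDl k l X : mxscale (k + l) X = mxscale k X + mxscale l X.
Proof. by apply/matrixP => i j; rewrite !mxE ascaleDl. Qed.

Lemma mxscale_half_half X : mxscale 2^-1 X + mxscale 2^-1 X = X.
Proof.
rewrite -mxscaleDl; apply/matrixP => i j; rewrite mxE.
have -> : 2^-1 + 2^-1 = 1 :> R by field.
exact: ascale1.
Qed.

Lemma mxscaleM k l X : mxscale k (mxscale l X) = mxscale (k * l) X.
Proof. by apply/matrixP => i j; rewrite !mxE ascaleA. Qed.

Lemma mxscaleD k X Y : mxscale k (X + Y) = mxscale k X + mxscale k Y.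
Proof. by apply/matrixP => i j; rewrite !mxE ascaleDr. Qed.

End MatrixFibers.

Section Adjoint.
Variables (R : realType) (D : Type) (B : atlas R D) (A : D -> pzAlgType R).
Variables (T : set (triv R (fun x => A x))) (sigma : forall x, A x -> A x).
Hypothesis hs : is_involution B T sigma.
Variable (x : D).

Lemma sigmaZD k (a b : A x) : sigma (ascale k a + b) = ascale k (sigma a) + sigma b.
Proof. by have [_ _ l _ _] := hs; exact: l. Qed.

Lemma sigmaD (a b : A x) : sigma (a + b) = sigma a + sigma b.
Proof. by have := sigmaZD 1 a b; rewrite !ascale1. Qed.

Lemma sigma0 : sigma (0 : A x) = 0.
Proof. by apply: (addIr (sigma (0 : A x))); rewrite -sigmaD !add0r. Qed.

Lemma sigmaZ k (a : A x) : sigma (ascale k a) = ascale k (sigma a).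
Proof. by have := sigmaZD k a 0; rewrite addr0 sigma0 addr0. Qed.

Lemma sigmaN (a : A x) : sigma (- a) = - sigma a.
Proof. by apply: (addIr (sigma a)); rewrite -sigmaD !addNr sigma0. Qed.

Lemma sigmaK : involutive (@sigma x).
Proof. by have [_ + _ _ _] := hs; exact. Qed.

Lemma sigmaM (a b : A x) : sigma (a * b) = sigma b * sigma a.
Proof. by have [_ _ _ _ +] := hs; exact. Qed.

Lemma sigma1 : sigma (1 : A x) = 1.
Proof. by have [_ _ _ + _] := hs; exact. Qed.

Lemma sigma_sum (I : Type) (r : seq I) (P : pred I) (F : I -> A x) :
  sigma (\sum_(i <- r | P i) F i) = \sum_(i <- r | P i) sigma (F i).
Proof. by apply: (big_morph (@sigma x)); [exact: sigmaD|exact: sigma0]. Qed.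

Variable n : nat.
Implicit Types X Y : 'M[A x]_n.

Lemma adjointK X : adjoint sigma (adjoint sigma X) = X.
Proof. by apply/matrixP => i j; rewrite !mxE sigmaK. Qed.

Lemma adjointD X Y : adjoint sigma (X + Y) = adjoint sigma X + adjoint sigma Y.
Proof. by apply/matrixP => i j; rewrite !mxE sigmaD. Qed.

Lemma adjointN X : adjoint sigma (- X) = - adjoint sigma X.
Proof. by apply/matrixP => i j; rewrite !mxE sigmaN. Qed.

Lemma adjointZ k X : adjoint sigma (mxscale k X) = mxscale k (adjoint sigma X).
Proof. by apply/matrixP => i j; rewrite !mxE sigmaZ. Qed.

Lemma adjointM X Y : adjoint sigma (X *m Y) = adjoint sigma Y *m adjoint sigma X.
Proof.
apply/matrixP => i j; rewrite !mxE sigma_sum; apply: eq_bigr => k _.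
by rewrite !mxE sigmaM.
Qed.

Lemma adjoint1 : adjoint sigma (1%:M : 'M[A x]_n) = 1%:M.
Proof.
apply/matrixP => i j; rewrite !mxE eq_sym.
by case: (i == j); [exact: sigma1|exact: sigma0].
Qed.

Lemma adjoint_form X J : adjoint sigma J = J ->
  adjoint sigma (adjoint sigma X *m J *m X) = adjoint sigma X *m J *m X.
Proof. by move=> HJ; rewrite !adjointM adjointK HJ mulmxA. Qed.

End Adjoint.

(** * Matrices over a family of algebras in coordinates *)

Section MatrixCoordinates.
Variables (R : realType) (D : Type) (B : atlas R D) (A : D -> pzAlgType R).
Variables (T : set (triv R (fun x => A x))) (hA : is_algebra_family B T).
Variables (t : triv R (fun x => A x)) (Tt : T t) (n : nat).

Definition mx_coord x (X : 'M[A x]_n) : 'rV[R]_(n * n * trank t) :=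
  tmap (mx_triv n t) X.

Definition mx_of_coord x (v : 'rV[R]_(n * n * trank t)) : 'M[A x]_n :=
  tinv (mx_triv n t) x v.

Section Fiber.
Variables (x : D) (tx : tdom t x).
Implicit Types X Y : 'M[A x]_n.

Lemma mx_coordK X : mx_of_coord x (mx_coord X) = X.
Proof. exact: (mx_tmapK hA Tt tx). Qed.

Lemma mx_of_coordK v : mx_coord (mx_of_coord x v) = v.
Proof. exact: (mx_tinvK hA Tt tx). Qed.

Lemma mx_coord_inj X Y : mx_coord X = mx_coord Y -> X = Y.
Proof. by move=> /(congr1 (mx_of_coord x)); rewrite !mx_coordK. Qed.

Lemma mx_coordZD k X Y : mx_coord (mxscale k X + Y) = k *: mx_coord X + mx_coord Y.
Proof.
apply/rowP => q; case/mxvec_indexP: q => p l; case/mxvec_indexP: p => i j.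
rewrite !mxE -![RHS]/(k * tmap (mx_triv n t) X 0 _ + tmap (mx_triv n t) Y 0 _).
rewrite -/(tmap (mx_triv n t) (mxscale k X + Y) 0 _).
rewrite !mx_tmapE.
by rewrite !mxE (tmapZD hA Tt _ _ _ tx) !mxE.
Qed.

Lemma mx_coordD X Y : mx_coord (X + Y) = mx_coord X + mx_coord Y.
Proof.
have := mx_coordZD 1 X Y; rewrite scale1r => <-; congr (mx_coord (_ + _)).
by apply/matrixP => i j; rewrite mxE ascale1.
Qed.

Lemma mx_coord0 : mx_coord (0 : 'M[A x]_n) = 0.
Proof. by apply: (addIr (mx_coord (0 : 'M[A x]_n))); rewrite -mx_coordD !add0r. Qed.

Lemma mx_coordZ k X : mx_coord (mxscale k X) = k *: mx_coord X.
Proof. by have := mx_coordZD k X 0; rewrite addr0 mx_coord0 addr0. Qed.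

Lemma mx_coordN X : mx_coord (- X) = - mx_coord X.
Proof. by apply: (addIr (mx_coord X)); rewrite -mx_coordD !addNr mx_coord0. Qed.

Lemma mx_of_coordZD k u v :
  mx_of_coord x (k *: u + v) = mxscale k (mx_of_coord x u) + mx_of_coord x v.
Proof. by apply: mx_coord_inj; rewrite mx_coordZD !mx_of_coordK. Qed.

(** A linear endomorphism of the matrices over the fiber at x, as a real matrix
    acting on coordinates. *)
Definition coord_mx (f : 'M[A x]_n -> 'M[A x]_n) : 'M[R]_(n * n * trank t) :=
  \matrix_i mx_coord (f (mx_of_coord x (delta_mx 0 i))).

Lemma coord_mxE (f : 'M[A x]_n -> 'M[A x]_n) Y :
  (forall k Y Z, f (mxscale k Y + Z) = mxscale k (f Y) + f Z) ->
  mx_coord (f Y) = mx_coord Y *m coord_mx f.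
Proof.
move=> lf; rewrite -[in LHS](mx_coordK Y).
apply: (linear_mxE (f := fun v => mx_coord (f (mx_of_coord x v)))) => k u v.
by rewrite mx_of_coordZD lf mx_coordZD.
Qed.

Lemma mulmx_lin X k Y Z :
  X *m (mxscale k Y + Z) = mxscale k (X *m Y) + X *m Z.
Proof. by rewrite mulmxDr mxscaleAr. Qed.

(** X is invertible exactly when left multiplication by X is an invertible real
    matrix.  In that case X Y = 1 has a solution Y, and X (Y X - 1) = 0 forces
    Y X = 1.  The determinant of X itself is of no use over a noncommutative
    algebra. *)
Lemma mx_invertible_coord X :
  mx_invertible X <-> coord_mx (mulmx X) \in unitmx.
Proof.
have HL Y : mx_coord (X *m Y) = mx_coord Y *m coord_mx (mulmx X).
  exact/coord_mxE/mulmx_lin.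
split=> [[Y [XY YX]]|uL].
  rewrite -row_free_unit -kermx_eq0; apply/eqP/row_matrixP => i.
  rewrite row0; set v := row i _.
  have vL : v *m coord_mx (mulmx X) = 0 by rewrite -row_mul mulmx_ker row0.
  have : X *m mx_of_coord x v = 0 by apply: mx_coord_inj; rewrite HL mx_of_coordK vL mx_coord0.
  move=> /(congr1 (mulmx Y)); rewrite mulmxA YX mul1mx mulmx0 => /(congr1 (@mx_coord x)).
  by rewrite mx_of_coordK mx_coord0.
pose Y := mx_of_coord x (mx_coord (1%:M : 'M[A x]_n) *m invmx (coord_mx (mulmx X))).
have XY : X *m Y = 1%:M.
  by apply: mx_coord_inj; rewrite HL mx_of_coordK mulmxKV.
exists Y; split=> //; apply/eqP; rewrite -subr_eq0; apply/eqP/mx_coord_inj.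
have : mx_coord (Y *m X - 1%:M) *m coord_mx (mulmx X) = 0.
  by rewrite -HL mulmxBr mulmxA XY mul1mx mulmx1 subrr mx_coord0.
by move=> /(congr1 (mulmx^~ (invmx (coord_mx (mulmx X))))); rewrite /= mulmxK // mul0mx mx_coord0.
Qed.

End Fiber.

Variables (c : chart R D) (Bc : B c).

Section Near.
Variables (m : nat) (beta : 'rV[R]_m -> D) (y : 'rV[R]_m).
Hypothesis sbeta : smooth_into c beta y.
Hypothesis tbeta : \forall z \near y, tdom t (beta z).

Lemma smooth_mx_of_coord v : smooth_mx t y (fun z => mx_of_coord (beta z) v).
Proof.
apply/smooth_mxE.
apply: smooth_at_eq (smooth_at_cst v y).
by apply: filterS tbeta => z tz; rewrite -[RHS]/(mx_coord (mx_of_coord (beta z) v)) mx_of_coordK.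
Qed.

Lemma smooth_coord_mx (f : forall z, 'M[A (beta z)]_n -> 'M[A (beta z)]_n) :
  (forall Y : forall z, 'M[A (beta z)]_n, smooth_mx t y Y ->
     smooth_mx t y (fun z => f z (Y z))) ->
  forall i j, smooth_at (fun z => coord_mx (f z) i j : R) y.
Proof.
move=> sf i j.
have /smooth_mxE/smooth_at_coordP/(_ j) := sf _ (smooth_mx_of_coord (delta_mx 0 i)).
by apply: smooth_at_eq; near=> z; rewrite mxE.
Unshelve. all: end_near. Qed.

Lemma near_invertible (X : forall z, 'M[A (beta z)]_n) : smooth_mx t y X ->
  mx_invertible (X y) -> \forall z \near y, mx_invertible (X z).
Proof.
move=> sX /(mx_invertible_coord (nbhs_singleton tbeta)).
rewrite unitmxE unitfE => d0.
have sL i j : smooth_at (fun z => coord_mx (mulmx (X z)) i j : R) y.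
  by apply: (smooth_coord_mx (f := fun z => mulmx (X z))) => Y sY;
    exact: (smooth_mxM hA Tt Bc sbeta tbeta).
have := continuous_neq0 (smooth_at_continuous (smooth_at_det sL)) d0.
apply: filterS2 tbeta => z tz dz; apply/(mx_invertible_coord tz).
by rewrite unitmxE unitfE.
Qed.

End Near.
End MatrixCoordinates.

Section Families.
Variables (R : realType) (D : Type) (B : atlas R D) (A : D -> pzAlgType R).
Variables (T : set (triv R (fun x => A x))) (hA : is_algebra_family B T).

Lemma trivializing_chart (x : D) : exists c t,
  [/\ B c, T t, cdom c x & tdom t x].
Proof.
have [_ BT [_ cT _] _ _] := hA.
have Bx : carrier B x by rewrite BT.
by have [c Bc dx] := Bx; have [t Tt tx] := cT x Bx; exists c, t.
Qed.

Lemma carrier_mx_atlas n p : carrier (mx_atlas B T n) p.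
Proof.
have [c [t [Bc Tt dx tx]]] := trivializing_chart (projT1 p).
exists (tot_chart c (mx_triv n t)); last by [].
by exists c => //; exists (mx_triv n t) => //; exists t.
Qed.

Lemma mx_atlas_in n c t : B c -> T t -> mx_atlas B T n (tot_chart c (mx_triv n t)).
Proof. by move=> Bc Tt; exists c => //; exists (mx_triv n t) => //; exists t. Qed.

Lemma GL_open n : mopen (mx_atlas B T n) (GL A n).
Proof.
apply: mopenP; first exact: mx_atlas_smooth.
  by move=> p _; exact: carrier_mx_atlas.
move=> _ p [c Bc [_ [t Tt <-] <-]] dp Gp.
have cc := mx_chart hA Tt Bc n.
have [_ cK] := cc.
have /smooth_into_mxP[sb tb sX] := smooth_into_cinv cc dp.
apply: (near_invertible hA Tt Bc sb tb sX).
by rewrite -[mx_invertible _]/(GL A n (cinv (tot_chart c (mx_triv n t))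
  (cmap (tot_chart c (mx_triv n t)) p))) cK.
Qed.

Lemma GL_atlas_smooth n : smooth_atlas (GL_atlas B T n).
Proof.
by apply: open_submanifold_smooth; [exact: mx_atlas_smooth|exact: GL_open].
Qed.

Lemma carrier_GL_atlas n p : carrier (GL_atlas B T n) p <-> GL A n p.
Proof.
split; first by move=> /(carrier_open_submanifold _ _ _)[].
move=> Gp; apply/carrier_open_submanifold; split=> //; exact: carrier_mx_atlas.
Qed.

Lemma GL_atlas_in n c t : B c -> T t ->
  GL_atlas B T n (restrict_chart (GL A n) (tot_chart c (mx_triv n t))).
Proof.
by move=> Bc Tt; exists (tot_chart c (mx_triv n t)) => //; exact: mx_atlas_in.
Qed.

Lemma GL_atlasP n C : GL_atlas B T n C -> exists c t,
  [/\ B c, T t & C = restrict_chart (GL A n) (tot_chart c (mx_triv n t))].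
Proof. by move=> [_ [c Bc [_ [t Tt <-] <-]] <-]; exists c, t. Qed.

Lemma GL_proj_smooth n : smooth_map (GL_atlas B T n) B (tot_proj (mxfam A n)).
Proof.
apply: smooth_mapP; first exact: GL_atlas_smooth.
  by move=> p _; have [_ -> _ _ _] := hA.
move=> C b p GC Bb dp db.
have Ccc : is_chart C by have [+ _] := GL_atlas_smooth n; exact.
have [_ CK] := Ccc.
have sC := smooth_into_cinv Ccc dp.
have [c [t [Bc Tt eC]]] := GL_atlasP GC; subst C.
move: sC => /smooth_into_restrict[/smooth_into_mxP[sb _ _] _].
by apply: (smooth_into_atlas (base_smooth hA) Bc Bb sb); rewrite CK.
Qed.

End Families.

(** * The unitary groups *)

Section Unitary.
Variables (R : realType) (D : Type) (B : atlas R D) (A : D -> pzAlgType R).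
Variables (T : set (triv R (fun x => A x))) (hA : is_algebra_family B T).
Variables (sigma : forall x, A x -> A x) (hs : is_involution B T sigma).
Variables (n : nat) (J : forall x, 'M[A x]_n).
Hypothesis hJ : smooth_map B (Herm_atlas B T sigma n)
            (fun x => existT (mxfam A n) x (J x)).
Hypothesis hJnondeg : forall x, mx_invertible (J x).

Lemma J_in_Herm x : carrier (Herm_atlas B T sigma n) (existT (mxfam A n) x (J x)).
Proof. by have [+ _] := hJ; apply; have [_ -> _ _ _] := hA. Qed.

Lemma J_adjoint x : adjoint sigma (J x) = J x.
Proof.
have [c' Hc' dc'] := J_in_Herm x.
by have [] := sub_atlas_dom Hc' dc'.
Qed.

(** J is given as a smooth map into the slice charts of the Hermitian family;
    these are restrictions of charts of the whole matrix family. *)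
Lemma J_smooth c t m (beta : 'rV[R]_m -> D) y : B c -> T t ->
  smooth_into c beta y -> (\forall z \near y, tdom t (beta z)) ->
  smooth_mx t y (fun z => J (beta z)).
Proof.
move=> Bc Tt sb tb.
have [c' Hc' dc'] := J_in_Herm (beta y).
have sJ := smooth_into_map (base_smooth hA) hJ Bc Hc' sb dc'.
have [_ H] := smooth_into_sub (mx_atlas_smooth hA n) Hc' sJ.
have mc := max_atlas_sub (mx_atlas_smooth hA n) (mx_atlas_in (A := A) n Bc Tt).
have sJ' := H _ mc (conj (smooth_into_dom sb) (nbhs_singleton tb)).
by have /smooth_into_mxP[] := sJ'.
Qed.

Variables (t : triv R (fun x => A x)) (Tt : T t).

Definition unitary_defect (p : tot (mxfam A n)) : 'M[A (projT1 p)]_n :=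
  let X : 'M[A (projT1 p)]_n := projT2 p in
  adjoint sigma X *m J (projT1 p) *m X - J (projT1 p).

Lemma unitary_defect0 p : tdom t (projT1 p) -> GL A n p ->
  unitary_group sigma J p <-> mx_coord t (unitary_defect p) = 0.
Proof.
move=> tp Gp; split=> [[_ e]|].
  by rewrite /unitary_defect e subrr (mx_coord0 hA Tt).
rewrite -(mx_coord0 hA Tt n tp) => /(mx_coord_inj hA Tt tp)/eqP.
by rewrite subr_eq0 => /eqP e; split.
Qed.

Lemma unitary_defect_smooth c m (P : 'rV[R]_m -> tot (mxfam A n)) y : B c ->
  smooth_into (tot_chart c (mx_triv n t)) P y ->
  smooth_at (fun z => mx_coord t (unitary_defect (P z))) y.
Proof.
move=> Bc /smooth_into_mxP[sb tb sX].
apply/smooth_mxE.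
have sJ := J_smooth Bc Tt sb tb.
apply: (smooth_mxB hA Tt tb) => //.
apply: (smooth_mxM hA Tt Bc sb tb) => //.
apply: (smooth_mxM hA Tt Bc sb tb) => //.
exact: (smooth_mx_adjoint hA Tt Bc sb tb hs sX).
Qed.

Lemma adjoint_lin x k (Y Z : 'M[A x]_n) :
  adjoint sigma (mxscale k Y + Z) = mxscale k (adjoint sigma Y) + adjoint sigma Z.
Proof. by rewrite (adjointD hs) (adjointZ hs). Qed.

Definition adjoint_mx x : 'M[R]_(n * n * trank t) :=
  coord_mx t (@adjoint R D A sigma n x).

Lemma adjoint_mxE x (Y : 'M[A x]_n) : tdom t x ->
  mx_coord t (adjoint sigma Y) = mx_coord t Y *m adjoint_mx x.
Proof. by move=> tx; apply: (coord_mxE hA Tt tx); exact: adjoint_lin. Qed.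

Lemma adjoint_mxK x : tdom t x -> adjoint_mx x *m adjoint_mx x = 1%:M.
Proof.
move=> tx; apply/row_matrixP => i; rewrite !rowE mulmxA mulmx1.
rewrite -[delta_mx 0 i](mx_of_coordK hA Tt tx).
by rewrite -!adjoint_mxE // (adjointK hs).
Qed.

Lemma unitary_defect_adjoint p :
  adjoint sigma (unitary_defect p) = unitary_defect p.
Proof.
by rewrite /unitary_defect (adjointD hs) (adjointN hs) (adjoint_form hs) ?J_adjoint.
Qed.

(** The direction X J^-1 H / 2 in which the defect grows like H. *)
Lemma unitary_defect_onto x (X H : 'M[A x]_n) :
  adjoint sigma X *m J x *m X = J x -> adjoint sigma H = H ->
  exists Y, forall s : R, unitary_defect (existT (mxfam A n) x (X + mxscale s Y)) =
    mxscale s H + mxscale (s ^+ 2) (adjoint sigma Y *m J x *m Y).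
Proof.
move=> XJ HH; have [Ji [JJi JiJ]] := hJnondeg x.
pose Y := X *m Ji *m mxscale 2^-1 H.
have XJY : adjoint sigma X *m J x *m Y = mxscale 2^-1 H.
  by rewrite /Y !mulmxA XJ JJi mul1mx.
have YJX : adjoint sigma Y *m J x *m X = mxscale 2^-1 H.
  rewrite -[in LHS]J_adjoint -[X in _ *m X](adjointK hs) -!(adjointM hs) mulmxA.
  by rewrite XJY (adjointZ hs) HH.
exists Y => s; rewrite /unitary_defect /=.
rewrite (adjointD hs) (adjointZ hs) !mulmxDl !mulmxDr XJ.
rewrite -!mxscaleAr XJY -!mxscaleAl YJX.
rewrite [mxscale s (mxscale s _)]mxscaleM -expr2.
rewrite -[in RHS](mxscale_half_half H) mxscaleD.
by rewrite addrC !addrA addNr add0r.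
Qed.

End Unitary.

Section UnitarySubfamily.
Variables (R : realType) (D : Type) (B : atlas R D) (A : D -> pzAlgType R).
Variables (T : set (triv R (fun x => A x))) (hA : is_algebra_family B T).
Variables (sigma : forall x, A x -> A x) (hs : is_involution B T sigma).
Variables (n : nat) (J : forall x, 'M[A x]_n).
Hypothesis hJ : smooth_map B (Herm_atlas B T sigma n)
            (fun x => existT (mxfam A n) x (J x)).
Hypothesis hJnondeg : forall x, mx_invertible (J x).

Lemma unitary_closed : mclosed (GL_atlas B T n) (unitary_group sigma J).
Proof.
have sG := GL_atlas_smooth hA n.
split; first by move=> p [Gp _]; exact: (iffRL (carrier_GL_atlas hA p) Gp).
apply: mopenP => //.
move=> C p GC dp [Cp Up].
have CC : is_chart C by have [+ _] := sG; exact.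
have [_ CK] := CC.
have sC := smooth_into_cinv CC dp.
have [c [t [Bc Tt eC]]] := GL_atlasP GC; subst C.
set C' := restrict_chart _ _ in GC dp CC CK sC *.
have /smooth_into_restrict[sP GP] := sC.
have sPhi := unitary_defect_smooth hA hs hJ Tt Bc sP.
have /smooth_into_mxP[sb tb sX] := sP.
have Phi0 : mx_coord t (unitary_defect sigma J (cinv C' (cmap C' p))) <> 0.
  have [[_ tp] Gp] := dp.
  rewrite CK // => /(unitary_defect0 hA sigma J Tt tp Gp); exact: Up.
have nPhi := continuous_vec_neq0 sPhi Phi0.
near=> z.
have Gz : GL A n (cinv C' z) by near: z.
split; first exact/(carrier_GL_atlas hA).
move=> Uz.
have : mx_coord t (unitary_defect sigma J (cinv C' z)) <> 0 by near: z.
have tz : tdom t (projT1 (cinv C' z)) by near: z.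
by apply; apply/(unitary_defect0 hA sigma J Tt tz Gz).
Unshelve. all: end_near. Qed.

(** The equation at p is the defect in coordinates, projected to the Hermitian
    matrices over the base point of p. *)
Lemma unitary_regular p : unitary_group sigma J p ->
  regular_at (GL_atlas B T n) B (tot_proj (mxfam A n)) (unitary_group sigma J) p.
Proof.
case: p => x X Up; have [Gp /= Xp] := Up.
set p : tot (mxfam A n) := existT _ x X in Up Gp *.
have [c [t [Bc Tt dx tx]]] := trivializing_chart hA x.
pose C := restrict_chart (GL A n) (tot_chart c (mx_triv n t)).
have GC : GL_atlas B T n C by exact: GL_atlas_in.
have sG := GL_atlas_smooth hA n.
have CC : is_chart C by have [+ _] := sG; exact.
have dp : cdom C p by [].
have CK : cinv C (cmap C p) = p by have [_] := CC; exact.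
have /smooth_into_restrict[sP GP] := smooth_into_cinv CC dp.
have sPhi := unitary_defect_smooth hA hs hJ Tt Bc sP.
have /smooth_into_mxP[sb tb sX] := sP.
have bc := base_is_chart hA Bc.
have cK : cinv c (cmap c x) = x by have [_] := bc; exact.
pose y0 := cmap C p.
have b0 : projT1 (cinv C y0) = x by rewrite CK.
pose rho z := adjoint_mx sigma n t (projT1 (cinv C z)).
have srho i j : smooth_at (fun z => rho z i j : R) y0.
  apply: (smooth_coord_mx hA Tt (beta := fun z => projT1 (cinv C z)) tb
    (f := fun z => @adjoint R D A sigma n (projT1 (cinv C z)))) => Y sY.
  exact: (smooth_mx_adjoint hA Tt Bc sb tb hs sY).
have nPhi : \forall z \near y0,
    mx_coord t (unitary_defect sigma J (cinv C z)) *m rho z =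
    mx_coord t (unitary_defect sigma J (cinv C z)).
  apply: filterS tb => z tz.
  by rewrite -(adjoint_mxE hA hs Tt) // (unitary_defect_adjoint hA hs hJ).
have rr : rho y0 *m rho y0 = 1%:M.
  have t0 : tdom t (projT1 (cinv C y0)) by rewrite b0.
  rewrite /rho; exact: (adjoint_mxK hA hs _ Tt t0).
have [l [Q [Q' [PhiQ QQ Qrho]]]] := involutive_equation srho rr nPhi.
pose F z := mx_coord t (unitary_defect sigma J (cinv C z)) *m Q.
have sF : smooth_at F y0 by exact: smooth_at_mulmxr.
have du e : 'D_e (fun z => cmap c (tot_proj (mxfam A n) (cinv C z))) y0 = lsubmx e.
  rewrite (@near_eq_derive _ _ _ _ (lsubmx : 'rV[R]_(cdim c + n * n * trank t) -> _)).
    have cL : continuous (lsubmx : 'rV[R]_(cdim c + n * n * trank t) -> 'rV[R]_(cdim c)).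
      exact: continuous_lsubmx.
    by rewrite deriveE ?diff_lin //; exact: linear_differentiable.
  have H : \forall z \near y0, (cmap c @` cdom c) (lsubmx z).
    have cl : {for y0, continuous (lsubmx : 'rV[R]_(cdim c + n * n * trank t) -> 'rV[R]_(cdim c))}.
      exact: continuous_lsubmx.
    apply: cl; rewrite /y0 /= row_mxKl; exact: near_image.
  by apply: filterS H => z /(cinvP bc)[].
exists C, c, l, F; split=> //.
- split=> //.
  near=> z.
  have Gz : GL A n (cinv C z) by near: z.
  have tz : tdom t (projT1 (cinv C z)) by near: z.
  have Pz : mx_coord t (unitary_defect sigma J (cinv C z)) *m Q = 0 <->
    mx_coord t (unitary_defect sigma J (cinv C z)) = 0 by near: z.
  rewrite /F Pz; exact: (unitary_defect0 hA sigma J Tt tz Gz).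
- by move=> w; exists (row_mx w 0); rewrite du row_mxKl.
move=> w.
pose h := w *m Q'.
rewrite /rho b0 in Qrho.
pose H : 'M[A x]_n := mx_of_coord x h.
have HH : adjoint sigma H = H.
  apply: (mx_coord_inj hA Tt tx); rewrite (adjoint_mxE hA hs Tt) // (mx_of_coordK hA Tt) //.
  by rewrite -mulmxA Qrho.
(* w Q' is fixed by the adjoint, so it represents a Hermitian matrix H, and
   F takes w Q' to w Q' Q = w. *)
have [Y HY] := unitary_defect_onto hA hs hJ hJnondeg Xp HH.
exists (row_mx 0 (mx_coord t Y)); split; first by rewrite du row_mxKl.
apply: (derive_quadratic
  (b := mx_coord t (adjoint sigma Y *m J x *m Y) *m Q)) => s.
have -> : cmap C p + s *: row_mx 0 (mx_coord t Y) =
    cmap (tot_chart c (mx_triv n t)) (existT (mxfam A n) x (X + mxscale s Y)).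
  rewrite scale_row_mx scaler0 [LHS]add_row_mx addr0 /=.
  congr row_mx; rewrite addrC -[RHS]/(mx_coord t (X + mxscale s Y)) addrC.
  by rewrite (mx_coordD hA Tt) // (mx_coordZ hA Tt).
have [_ mK] := mx_chart hA Tt Bc n.
rewrite /F -[cinv C]/(cinv (tot_chart c (mx_triv n t))) mK; last by [].
rewrite HY (mx_coordD hA Tt) // !(mx_coordZ hA Tt) // mulmxDl -!scalemxAl (mx_of_coordK hA Tt) //.
by rewrite /h -(mulmxA w) QQ mulmx1.
Unshelve. all: end_near. Qed.

Lemma unitary_subfamily :
  is_subfamily (GL_atlas B T n) B (tot_proj (mxfam A n)) (unitary_group sigma J).
Proof.
apply: regular_subfamily.
- exact: GL_atlas_smooth.
- exact: base_smooth hA.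
- exact: GL_proj_smooth.
- exact: unitary_closed.
- exact: unitary_regular.
Qed.

End UnitarySubfamily.

(** * Curves of unitary scalars *)

(** The fibers are commutative by hypothesis and not by their type, so the theory
    of determinants is transported from the commutative ring structure that the
    hypothesis provides. *)
Section CommutativeDeterminants.
Variables (K : pzRingType) (mulC : forall a b : K, a * b = b * a).

Let comK : comPzRingType :=
  HB.pack (GRing.PzRing.sort K) (GRing.PzRing_hasCommutativeMul.Build K mulC).

Lemma det_mulmx_comm n (M N : 'M[K]_n) : \det (M *m N) = \det M * \det N.
Proof. exact: (@det_mulmx comK n M N). Qed.

Lemma det_tr_comm n (M : 'M[K]_n) : \det M^T = \det M.
Proof. exact: (@det_tr comK n M). Qed.

Lemma det_scalar_comm n (a : K) : \det (a%:M : 'M[K]_n) = a ^+ n.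
Proof. exact: (@det_scalar comK n a). Qed.

Lemma det1_comm n : \det (1%:M : 'M[K]_n) = 1.
Proof. exact: (@det1 comK n). Qed.

Lemma det_mx00_comm n (M : 'M[K]_n) : n = 0%N -> \det M = 1.
Proof. by move=> n0; move: M; rewrite n0 => M; exact: (@det_mx00 comK M). Qed.

Lemma scalar_mx_comm n (a : K) (M : 'M[K]_n) : M *m a%:M = a%:M *m M.
Proof. exact: (@scalar_mxC comK n n a M). Qed.

Lemma mulmx11C (M N : 'M[K]_1) : M *m N = N *m M.
Proof. by rewrite (mx11_scalar N) scalar_mx_comm. Qed.

End CommutativeDeterminants.

Section DerivativeOnLine.
Variable R : realType.

(** The product rule at a zero of the first factor, where continuity of the
    second one is enough. *)
Lemma derive_scaled N (F G : 'rV[R]_1 -> 'rV[R]_N) :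
  {for 0, continuous G} -> (\forall w \near (0 : 'rV[R]_1), F w = w 0 0 *: G w) ->
  'D_(const_mx 1) F 0 = G 0.
Proof.
move=> cG FG.
have F0 : F 0 = 0 by rewrite (nbhs_singleton FG) mxE scale0r.
pose line (s : R) : 'rV[R]_1 := s *: const_mx 1 + 0.
have l0 : line @ (0 : R)^' --> (0 : 'rV[R]_1).
  have -> : nbhs (0 : 'rV[R]_1) = nbhs ((0 : R) *: (const_mx 1 : 'rV[R]_1) + 0).
    by rewrite scale0r addr0.
  apply: cvgD; last exact: cvg_cst.
  apply: cvgZr_tmp; exact: (@nbhs_dnbhs _ (0 : R)).
rewrite /derive; apply: cvg_lim => //.
have cGl : G \o line @ (0 : R)^' --> G 0 by apply: cvg_comp l0 cG.
apply: cvg_trans cGl; apply: (near_eq_cvg (F := (0:R)^')).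
have nF := l0 _ FG; near=> s.
have s0 : s != 0 by near: s; exact: nbhs_dnbhs_neq.
have FE : F (line s) = line s 0 0 *: G (line s) by near: s; exact: nF.
rewrite /= -/(line s) F0 subr0 FE scalerA.
by rewrite !mxE mulr1 addr0 mulVf // scale1r.
Unshelve. all: end_near. Qed.

End DerivativeOnLine.

Section CayleyCurve.
Variables (R : realType) (D : Type) (B : atlas R D) (A : D -> pzAlgType R).
Variables (T : set (triv R (fun x => A x))) (hA : is_algebra_family B T).
Variables (sigma : forall x, A x -> A x) (hs : is_involution B T sigma).
Hypothesis mulC : forall x (a b : A x), a * b = b * a.
Variables (c : chart R D) (t : triv R (fun x => A x)) (Bc : B c) (Tt : T t).
Variables (x : D) (dx : cdom c x) (tx : tdom t x).

Lemma smooth_into_cst m (y : 'rV[R]_m) : smooth_into c (fun=> x) y.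
Proof. by split; [near=> z|exact: smooth_at_cst]. Unshelve. all: end_near. Qed.

Lemma smooth_mx_cst n (X : 'M[A x]_n) m (y : 'rV[R]_m) :
  smooth_mx t (beta := fun=> x) y (fun=> X).
Proof. by move=> i j; exact: smooth_at_cst. Qed.

Lemma smooth_mx_line n (X Y : 'M[A x]_n) (w0 : 'rV[R]_1) :
  smooth_mx t (beta := fun=> x) w0 (fun w => X + mxscale (w 0 0) Y).
Proof.
have tb : \forall z \near w0, tdom t x by near=> z.
move=> i j.
have s1 : smooth_section t (beta := fun=> x) w0 (fun w => X i j + ascale (w 0 0) (Y i j)).
  apply: (smooth_sectionD hA Tt tb); first exact: smooth_at_cst.
  apply: (smooth_sectionZ hA Tt tb); last exact: smooth_at_cst.
  by have /smooth_at_coordP := smooth_at_id w0; exact.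
by apply: smooth_section_eq s1; near=> w; rewrite !mxE.
Unshelve. all: end_near. Qed.

Variable a : 'M[A x]_1.
Hypothesis skew_a : adjoint sigma a = - a.

(** The Cayley transform (1 + s a) / (1 - s a), in the algebra over x.  Scalars
    are treated as 1 x 1 matrices in order to reuse coordinates of matrices, and
    the parameter s as a row vector w of length 1. *)
Definition cayley_num (w : 'rV[R]_1) : 'M[A x]_1 := 1%:M + mxscale (w 0 0) a.
Definition cayley_den (w : 'rV[R]_1) : 'M[A x]_1 := 1%:M + mxscale (w 0 0) (- a).
(** The solution of (1 - s a) b = 1, obtained by inverting the real matrix of the
    multiplication by 1 - s a; it is smooth in s by Cramer's rule. *)
Definition cayley_inv (w : 'rV[R]_1) : 'M[A x]_1 :=
  mx_of_coord x (mx_coord t (1%:M : 'M[A x]_1) *m invmx (coord_mx t (mulmx (cayley_den w)))).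
Definition cayley (w : 'rV[R]_1) : A x := (cayley_num w *m cayley_inv w) 0 0.

Let tb : \forall z \near (0 : 'rV[R]_1), tdom t x.
Proof. by near=> z. Unshelve. all: end_near. Qed.
Let sb := smooth_into_cst (0 : 'rV[R]_1).

Lemma mxscale0 n (Y : 'M[A x]_n) : mxscale 0 Y = 0.
Proof. by apply: (addIr (mxscale 0 Y)); rewrite -mxscaleDl !add0r. Qed.

Lemma cayley_den0 : cayley_den 0 = 1%:M.
Proof. by rewrite /cayley_den mxE mxscale0 addr0. Qed.

Lemma cayley_den_unit0 : coord_mx t (mulmx (cayley_den 0)) \in unitmx.
Proof.
apply/(mx_invertible_coord hA Tt tx); exists 1%:M.
by rewrite cayley_den0 mul1mx.
Qed.

Lemma smooth_den i j :
  smooth_at (fun w => coord_mx t (mulmx (cayley_den w)) i j : R) 0.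
Proof.
apply: (smooth_coord_mx hA Tt (beta := fun=> x) tb
  (f := fun w => mulmx (cayley_den w))) => Y sY.
by apply: (smooth_mxM hA Tt Bc sb tb) => //; exact: smooth_mx_line.
Qed.

Lemma smooth_cayley_inv :
  smooth_mx t (beta := fun=> x) 0 cayley_inv.
Proof.
apply/smooth_mxE.
apply: (@smooth_at_eq _ _ _ (fun w => mx_coord t (1%:M : 'M[A x]_1) *m
   invmx (coord_mx t (mulmx (cayley_den w))))).
  near=> w; rewrite -[RHS]/(mx_coord t (cayley_inv w)) (mx_of_coordK hA Tt) //.
apply/smooth_at_coordP => j.
apply: (@smooth_at_eq _ _ _ (fun w => \sum_k mx_coord t (1%:M : 'M[A x]_1) 0 k *
   invmx (coord_mx t (mulmx (cayley_den w))) k j)).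
  by near=> w; rewrite [RHS]mxE.
apply: smooth_at_sum => k; apply: smooth_atM; first exact: smooth_at_cst.
by apply: smooth_at_invmx; [exact: cayley_den_unit0|exact: smooth_den].
Unshelve. all: end_near. Qed.

Lemma near_cayley_inv :
  \forall w \near (0 : 'rV[R]_1), cayley_den w *m cayley_inv w = 1%:M.
Proof.
have d0 : \det (coord_mx t (mulmx (cayley_den 0))) != 0.
  by have := cayley_den_unit0; rewrite unitmxE unitfE.
have := continuous_neq0 (smooth_at_continuous (smooth_at_det smooth_den)) d0.
apply: filterS => w dw; apply: (mx_coord_inj hA Tt tx).
rewrite (coord_mxE hA Tt tx (f := mulmx (cayley_den w))); last exact: mulmx_lin.
by rewrite (mx_of_coordK hA Tt) // mulmxKV // unitmxE unitfE.
Qed.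

Lemma cayley_inv0 : cayley_inv 0 = 1%:M.
Proof.
by have := nbhs_singleton near_cayley_inv; rewrite cayley_den0 mul1mx.
Qed.

Lemma smooth_cayley : smooth_section t (beta := fun=> x) 0 cayley.
Proof.
apply: (smooth_mxM hA Tt Bc sb tb); first exact: smooth_mx_line.
exact: smooth_cayley_inv.
Qed.

Lemma cayley0 : cayley 0 = 1.
Proof.
rewrite /cayley cayley_inv0 mulmx1 /cayley_num [X in mxscale X]mxE mxscale0 addr0.
by rewrite mxE.
Qed.

(** For skew a, sigma exchanges 1 + s a and 1 - s a. *)
Lemma cayley_unitary :
  \forall w \near (0 : 'rV[R]_1), sigma (cayley w) * cayley w = 1.
Proof.
apply: filterS near_cayley_inv => w Hw.
have an : adjoint sigma (cayley_num w) = cayley_den w.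
  rewrite /cayley_num (adjointD hs) (adjoint1 hs) (adjointZ hs) skew_a.
  by [].
have ad : adjoint sigma (cayley_den w) = cayley_num w by rewrite -an (adjointK hs).
set q := cayley_num w *m cayley_inv w.
have Hw' := congr1 (@adjoint R D A sigma 1 x) Hw.
rewrite (adjointM hs) ad (adjoint1 hs) in Hw'.
have : adjoint sigma q *m q = 1%:M.
  rewrite (adjointM hs) an mulmxA -(mulmxA _ (cayley_den w)).
  by rewrite (mulmx11C (mulC (x:=x)) (cayley_den w)) mulmxA Hw' mul1mx.
have e1 : adjoint sigma q 0 0 = sigma (q 0 0) by rewrite mxE mxE.
by move=> /matrixP/(_ 0 0); rewrite mxE big_ord1 e1 [RHS]mxE eqxx.
Qed.

(** The difference quotient of the n-th power of the Cayley transform r: since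
    r - 1 = 2 s a b with b = (1 - s a)^-1, the power r^n is 1 + s G(s) with
    G(s) = 2 a b (1 + r + ... + r^(n-1)). *)
Definition cayley_slope n (w : 'rV[R]_1) : A x :=
  (a 0 0 * cayley_inv w 0 0 + a 0 0 * cayley_inv w 0 0) *
  \sum_(i < n) cayley w ^+ i.

Lemma smooth_cayley_slope n :
  smooth_section t (beta := fun=> x) 0 (cayley_slope n).
Proof.
have sab : smooth_section t (beta := fun=> x) 0 (fun w => a 0 0 * cayley_inv w 0 0).
  apply: (smooth_sectionM hA Tt Bc sb tb); first exact: smooth_at_cst.
  exact: smooth_cayley_inv.
apply: (smooth_sectionM hA Tt Bc sb tb).
  exact: (smooth_sectionD hA Tt tb).
apply: (smooth_section_sum hA Tt tb) => i.
apply: (smooth_sectionX hA Tt Bc sb tb); exact: smooth_cayley.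
Qed.

Lemma cayley_power n : \forall w \near (0 : 'rV[R]_1),
  cayley w ^+ n = 1 + ascale (w 0 0) (cayley_slope n w).
Proof.
apply: filterS near_cayley_inv => w Hw.
apply/eqP; rewrite addrC -subr_eq; apply/eqP.
rewrite subrX1 /cayley_slope ascaleAl; congr (_ * _).
have : cayley_num w *m cayley_inv w - 1%:M =
    mxscale (w 0 0) (a *m cayley_inv w + a *m cayley_inv w).
  rewrite -{1}Hw -mulmxBl /cayley_num /cayley_den.
  have -> : mxscale (w 0 0) (- a) = - mxscale (w 0 0) a.
    apply: (addIr (mxscale (w 0 0) a)); rewrite -mxscaleD !addNr.
    by apply/matrixP => i j; rewrite !mxE ascale0r.
  rewrite opprD opprK addrACA subrr add0r mulmxDl -!mxscaleAl -mxscaleD.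
  by [].
move=> /matrixP/(_ 0 0); rewrite mxE [X in _ + X]mxE [X in _ + - X]mxE /= => ->.
have E : (a *m cayley_inv w) 0 0 = a 0 0 * cayley_inv w 0 0.
  by rewrite mxE big_ord1.
by rewrite mxE [X in ascale _ X]mxE E.
Qed.

Lemma cayley_slope0 n : cayley_slope n 0 = ascale (2 * n%:R) (a 0 0).
Proof.
rewrite /cayley_slope cayley_inv0 mxE mulr1.
have -> : \sum_(i < n) cayley 0 ^+ i = n%:R :> A x.
  rewrite cayley0 (eq_bigr (fun=> 1)) => [|i _]; last by rewrite expr1n.
  by rewrite sumr_const card_ord.
rewrite mulr_natr.
have H k (b : A x) : b *+ k = ascale k%:R b.
  elim: k => [|k IH].
    by rewrite mulr0n; apply: (addIr (ascale 0 b)); rewrite -ascaleDl !add0r.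
  by rewrite mulrS -natr1 ascaleDl ascale1 addrC IH.
by rewrite -mulr2n !H ascaleA mulrC.
Qed.

End CayleyCurve.

(** * The special unitary groups *)

Section SpecialUnitary.
Variables (R : realType) (D : Type) (B : atlas R D) (A : D -> pzAlgType R).
Variables (T : set (triv R (fun x => A x))) (hA : is_algebra_family B T).
Variables (sigma : forall x, A x -> A x) (hs : is_involution B T sigma).
Variables (n : nat) (J : forall x, 'M[A x]_n).
Hypothesis hJ : smooth_map B (Herm_atlas B T sigma n)
            (fun x => existT (mxfam A n) x (J x)).
Hypothesis hJnondeg : forall x, mx_invertible (J x).
Hypothesis mulC : forall x (a b : A x), a * b = b * a.

Definition tot_det (p : tot (mxfam A n)) : A (projT1 p) :=
  \det (projT2 p : 'M[A (projT1 p)]_n).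

Lemma sigma_prod x (I : Type) (r : seq I) (P : pred I) (F : I -> A x) :
  sigma (\prod_(i <- r | P i) F i) = \prod_(i <- r | P i) sigma (F i).
Proof.
apply: (big_morph (@sigma x)); last exact: (sigma1 hs).
by move=> a b; rewrite (sigmaM hs) mulC.
Qed.

Lemma det_adjoint x (X : 'M[A x]_n) : \det (adjoint sigma X) = sigma (\det X).
Proof.
rewrite (det_tr_comm (mulC (x:=x))) (sigma_sum hs); apply: eq_bigr => s _.
rewrite (sigmaM hs) mulC sigma_prod; congr (_ * _).
  by case: (perm.odd_perm s); rewrite ?expr0 ?expr1 ?(sigmaN hs) (sigma1 hs).
by apply: eq_bigr => i _; rewrite mxE.
Qed.

(** Take determinants in X^dagger J X = J and cancel det J. *)
Lemma unitary_det p : unitary_group sigma J p ->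
  sigma (tot_det p) * tot_det p = 1.
Proof.
case: p => x X [_ /= e]; have [Ji [JJi _]] := hJnondeg x.
have detJ : \det (J x) * \det Ji = 1.
  by rewrite -(det_mulmx_comm (mulC (x:=x))) JJi (det1_comm (mulC (x:=x))).
have := congr1 (@determinant _ n) e.
rewrite !(det_mulmx_comm (mulC (x:=x))) det_adjoint => E.
rewrite /tot_det /=.
have : sigma (\det X) * \det (J x) * \det X * \det Ji = \det (J x) * \det Ji.
  by rewrite E.
by rewrite -[_ * _ * \det X]mulrA (mulC (\det (J x)) (\det X)) mulrA -!mulrA detJ mulr1.
Qed.

(** Twice the skew part of the determinant.  The 1 x 1 matrix makes the adjoint
    and the coordinates of matrices applicable. *)
Definition det_defect (p : tot (mxfam A n)) : 'M[A (projT1 p)]_1 :=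
  (tot_det p - sigma (tot_det p))%:M.

Lemma adjoint_scalar x k (a : A x) :
  adjoint sigma (a%:M : 'M[A x]_k) = (sigma a)%:M.
Proof.
apply/matrixP => i j; rewrite !mxE eq_sym.
by case: (i == j); rewrite ?mulr1n ?mulr0n // (sigma0 hs).
Qed.

Lemma det_defect_skew p : adjoint sigma (det_defect p) = - det_defect p.
Proof.
rewrite adjoint_scalar (sigmaD hs) (sigmaN hs) (sigmaK hs) -raddfN /=.
by rewrite opprB addrC.
Qed.

Lemma scalar11_inj (K : pzRingType) (a b : K) : a%:M = b%:M :> 'M[K]_1 -> a = b.
Proof. by move=> /matrixP/(_ 0 0); rewrite !mxE. Qed.

(** If d = sigma(d) and sigma(d) d = 1, then (d - 1) (d + 1) = 0. *)
Lemma det_defect0 p : unitary_group sigma J p ->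
  mx_invertible ((tot_det p + 1)%:M : 'M[A (projT1 p)]_1) ->
  special_unitary_group sigma J p <-> det_defect p = 0.
Proof.
move=> Up [Y [dY Yd]]; split=> [[_ d1]|].
  by rewrite /det_defect /tot_det d1 (sigma1 hs) subrr raddf0.
rewrite /det_defect => e.
have /eqP : tot_det p - sigma (tot_det p) = 0.
  by apply: scalar11_inj; rewrite e raddf0.
rewrite subr_eq0 => /eqP ds; split=> //.
have dd : tot_det p * tot_det p = 1 by rewrite {1}ds unitary_det.
apply/eqP; rewrite -[\det _]/(tot_det p) -subr_eq0; apply/eqP.
apply: scalar11_inj; rewrite raddf0.
rewrite -[LHS]mulmx1 -dY mulmxA -scalar_mxM.
rewrite mulrDr mulr1 mulrBl mul1r dd addrC addrA subrK subrr.
by rewrite raddf0 mul0mx.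
Qed.

Section Smooth.
Variables (c : chart R D) (t : triv R (fun x => A x)) (Bc : B c) (Tt : T t).
Variables (m : nat) (P : 'rV[R]_m -> tot (mxfam A n)) (y : 'rV[R]_m).
Hypothesis sP : smooth_into (tot_chart c (mx_triv n t)) P y.

Lemma smooth_tot_det :
  smooth_section t (beta := fun z => projT1 (P z)) y (fun z => tot_det (P z)).
Proof.
have /smooth_into_mxP[sb tb sX] := sP.
exact: (smooth_section_det hA Tt Bc sb tb sX).
Qed.

Lemma smooth_det_defect : smooth_at (fun z => mx_coord t (det_defect (P z))) y.
Proof.
have /smooth_into_mxP[sb tb sX] := sP.
apply/smooth_mxE/(smooth_mx_scalar hA Tt tb).
apply: (smooth_sectionD hA Tt tb); first exact: smooth_tot_det.
apply: (smooth_sectionN hA Tt tb).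
apply: (smooth_section_sigma hA Tt Bc sb tb hs); exact: smooth_tot_det.
Qed.

Lemma near_det_unit : tot_det (P y) = 1 ->
  \forall z \near y, mx_invertible ((tot_det (P z) + 1)%:M : 'M[A (projT1 (P z))]_1).
Proof.
have /smooth_into_mxP[sb tb sX] := sP.
move=> d1; apply: (near_invertible hA Tt Bc sb tb
    (X := fun z => (tot_det (P z) + 1)%:M : 'M[A (projT1 (P z))]_1)).
  apply/(smooth_mx_scalar hA Tt tb)/(smooth_sectionD hA Tt tb).
    exact: smooth_tot_det.
  exact: (smooth_section1 hA Tt Bc sb tb).
rewrite d1; exists (ascale 2^-1 1)%:M.
have H : ((1 + 1) * ascale 2^-1 1 = 1 :> A (projT1 (P y))).
  rewrite mulrDl !mul1r -ascaleDl (_ : 2^-1 + 2^-1 = 1 :> R) ?ascale1 //.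
  by field.
by rewrite -!scalar_mxM (mulC (ascale _ _)) H.
Qed.

End Smooth.

Lemma carrier_unitary p : carrier (U_atlas B T sigma J) p <-> unitary_group sigma J p.
Proof.
split; first by move=> [c' Sc' dp]; have [] := sub_atlas_dom Sc' dp.
have [_ [_ +] _] := unitary_subfamily hA hs hJ hJnondeg; exact.
Qed.

(** The charts of the unitary family are arbitrary slice charts; this gives
    access to bundle coordinates from any of them. *)
Lemma unitary_chart_smooth c1 p c t : U_atlas B T sigma J c1 -> cdom c1 p ->
  B c -> T t -> cdom c (projT1 p) -> tdom t (projT1 p) ->
  (\forall z \near cmap c1 p, unitary_group sigma J (cinv c1 z)) /\
  smooth_into (tot_chart c (mx_triv n t)) (cinv c1) (cmap c1 p).
Proof.
move=> Uc1 dp Bc Tt dx tx.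
have sG := GL_atlas_smooth hA n.
have c1c := sub_atlas_is_chart Uc1.
have c1K : cinv c1 (cmap c1 p) = p by have [_] := c1c; exact.
have [nU H] := smooth_into_sub sG Uc1 (smooth_into_cinv c1c dp).
split=> //.
have mC := max_atlas_sub sG (GL_atlas_in (A := A) n Bc Tt).
have [[Gp _] _] := sub_atlas_dom Uc1 dp.
have := H _ mC; rewrite c1K => /(_ (conj (conj dx tx) Gp)).
by move=> /smooth_into_restrict[].
Qed.

Lemma special_unitary_closed :
  mclosed (U_atlas B T sigma J) (special_unitary_group sigma J).
Proof.
have sU := sub_atlas_smooth (unitary_group sigma J) (GL_atlas_smooth hA n).
split; first by move=> p [Up _]; exact/carrier_unitary.
apply: mopenP => // c1 p Uc1 dp [Up Sp].
have [c [t [Bc Tt dx tx]]] := trivializing_chart hA (projT1 p).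
have [nU sP] := unitary_chart_smooth Uc1 dp Bc Tt dx tx.
have /smooth_into_mxP[sb tb sX] := sP.
have c1c := sub_atlas_is_chart Uc1.
have c1K : cinv c1 (cmap c1 p) = p by have [_] := c1c; exact.
have s1 : smooth_section t (beta := fun z => projT1 (cinv c1 z)) (cmap c1 p)
    (fun z => tot_det (cinv c1 z) - 1).
  apply: (smooth_sectionD hA Tt tb); first exact: (smooth_tot_det Bc Tt sP).
  apply: (smooth_sectionN hA Tt tb); exact: (smooth_section1 hA Tt Bc sb tb).
have n0 : tmap t (tot_det (cinv c1 (cmap c1 p)) - 1) <> 0.
  rewrite c1K -(tmap0 hA Tt tx) => /(tmap_inj hA Tt tx)/eqP.
  rewrite subr_eq0 => /eqP d1; apply: Sp; split=> //.
  exact/carrier_unitary.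
have n1 : \forall z \near cmap c1 p, tmap t (tot_det (cinv c1 z) - 1) <> 0.
  exact: continuous_vec_neq0 s1 n0.
near=> z.
have Uz : unitary_group sigma J (cinv c1 z) by near: z.
split; first exact/carrier_unitary.
move=> [_ d1].
have : tmap t (tot_det (cinv c1 z) - 1) <> 0 by near: z.
have tz : tdom t (projT1 (cinv c1 z)) by near: z.
by apply; rewrite /tot_det d1 subrr (tmap0 hA Tt tz).
Unshelve. all: end_near. Qed.

Lemma unitary_scale x (X : 'M[A x]_n) (r : A x) : sigma r * r = 1 ->
  unitary_group sigma J (existT (mxfam A n) x X) ->
  unitary_group sigma J (existT (mxfam A n) x (X *m r%:M)).
Proof.
move=> rr [[Y /= [XY YX]] /= XJ].
have SS' : r%:M *m (sigma r)%:M = 1%:M :> 'M[A x]_n by rewrite -scalar_mxM mulC rr.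
have S'S : (sigma r)%:M *m r%:M = 1%:M :> 'M[A x]_n by rewrite -scalar_mxM rr.
split.
  exists ((sigma r)%:M *m Y) => /=; split.
    by rewrite mulmxA -(mulmxA X) SS' mulmx1.
  by rewrite mulmxA -(mulmxA _ Y) YX mulmx1.
rewrite /= (adjointM hs) adjoint_scalar.
rewrite mulmxA -!(mulmxA (sigma r)%:M) XJ.
by rewrite (scalar_mx_comm (mulC (x:=x))) mulmxA S'S mul1mx.
Qed.

(** Vectors of U(J) over every tangent vector of the base exist because U(J) is
    already known to submerge onto it; vertical vectors on which the equation
    takes a prescribed value are velocities of curves X r, with r a Cayley
    transform. *)
Lemma special_unitary_regular p : special_unitary_group sigma J p ->
  regular_at (U_atlas B T sigma J) B (tot_proj (mxfam A n))
    (special_unitary_group sigma J) p.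
Proof.
case: p => x X; set p : tot (mxfam A n) := existT _ x X => Sp.
have [Up dp1] := Sp; rewrite -/(tot_det p) in dp1.
have [_ _ [smU subm]] := unitary_subfamily hA hs hJ hJnondeg.
have sG := GL_atlas_smooth hA n.
have sU : smooth_atlas (U_atlas B T sigma J) by exact: sub_atlas_smooth.
have [c [t [Bc Tt dx tx]]] := trivializing_chart hA x.
have [c1 Uc1 dp] := (iffRL (carrier_unitary p)) Up.
have [nU sP] := unitary_chart_smooth Uc1 dp Bc Tt dx tx.
have /smooth_into_mxP[sb tb sX] := sP.
have c1c := sub_atlas_is_chart Uc1.
have c1K : cinv c1 (cmap c1 p) = p by have [_] := c1c; exact.
pose u z := cmap c (tot_proj (mxfam A n) (cinv c1 z)).
have su : smooth_at u (cmap c1 p) by have [] := sb.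
have Hu w : exists e, 'D_e u (cmap c1 p) = w.
  have := subm c1 c p Uc1 Bc dp dx => rg.
  have : range ('d (cmap c \o tot_proj (mxfam A n) \o cinv c1) (cmap c1 p)) w by rewrite rg.
  move=> [e _ <-]; exists e; rewrite deriveE //.
  exact: smooth_at_differentiable su.
have nunit := near_det_unit Bc Tt sP.
rewrite c1K in nunit; have {}nunit := nunit dp1.
(* For n = 0 every determinant is 1 and there is no equation to impose; the
   choice of a below divides by n. *)
have [n0|n_gt0] := posnP n.
  exists c1, c, 0%N, (fun=> 0); split=> //.
    split; first exact: smooth_at_cst.
    apply: filterS nU => z Uz; split=> // _; split=> //.
    by apply: (det_mx00_comm (@mulC _)).
  by move=> z; exists 0; rewrite !derive0; split=> //; apply/rowP => -[].
(* The defect is skew, that is fixed by the opposite of the adjoint. *)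
pose rho z := - adjoint_mx sigma 1 t (projT1 (cinv c1 z)).
have srho i j : smooth_at (fun z => rho z i j : R) (cmap c1 p).
  apply: (@smooth_at_eq _ _ _ (fun z => -1 * adjoint_mx sigma 1 t (projT1 (cinv c1 z)) i j)).
    by near=> z; rewrite [RHS]mxE mulN1r.
  apply: smooth_atM; first exact: smooth_at_cst.
  apply: (smooth_coord_mx hA Tt (beta := fun z => projT1 (cinv c1 z)) tb
    (f := fun z => @adjoint R D A sigma 1 (projT1 (cinv c1 z)))) => Y sY.
  exact: (smooth_mx_adjoint hA Tt Bc sb tb hs sY).
have nPhi : \forall z \near cmap c1 p,
    mx_coord t (det_defect (cinv c1 z)) *m rho z = mx_coord t (det_defect (cinv c1 z)).
  apply: filterS tb => z tz.
  rewrite /rho mulmxN -(adjoint_mxE hA hs Tt) // det_defect_skew.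
  by rewrite (mx_coordN hA Tt) // opprK.
have rr : rho (cmap c1 p) *m rho (cmap c1 p) = 1%:M.
  have t0 := nbhs_singleton tb.
  by rewrite /rho mulmxN mulNmx opprK; exact: (adjoint_mxK hA hs _ Tt t0).
have [l [Q [Q' [PhiQ QQ Qrho]]]] := involutive_equation srho rr nPhi.
pose Fd q := mx_coord t (det_defect q) *m Q.
pose F z := Fd (cinv c1 z).
have sF : smooth_at F (cmap c1 p).
  apply: smooth_at_mulmxr; exact: (smooth_det_defect Bc Tt sP).
exists c1, c, l, F; split=> //.
  split=> //; near=> z.
  have Uz : unitary_group sigma J (cinv c1 z) by near: z.
  have tz : tdom t (projT1 (cinv c1 z)) by near: z.
  have Pz : mx_coord t (det_defect (cinv c1 z)) *m Q = 0 <->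
    mx_coord t (det_defect (cinv c1 z)) = 0 by near: z.
  have iz : mx_invertible ((tot_det (cinv c1 z) + 1)%:M :
    'M[A (projT1 (cinv c1 z))]_1) by near: z.
  rewrite /F /Fd Pz (det_defect0 Uz iz).
  by split=> [->|e]; [exact: (mx_coord0 hA Tt)|apply: (mx_coord_inj hA Tt tz); rewrite e (mx_coord0 hA Tt)].
move=> w; pose h := w *m Q'.
rewrite /rho c1K /= in Qrho.
(* Along the curve of a the defect r^n - sigma(r^n) has derivative 4 n a. *)
pose a : 'M[A x]_1 := mxscale (4 * n%:R)^-1 (mx_of_coord x h).
have a_skew : adjoint sigma a = - a.
  apply: (mx_coord_inj hA Tt tx); rewrite (adjoint_mxE hA hs Tt) // (mx_coordN hA Tt) //.
  rewrite (mx_coordZ hA Tt) // (mx_of_coordK hA Tt) // -scalemxAl -scalerN; congr (_ *: _).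
  by rewrite /h -[in RHS]Qrho mulmxN mulmxN opprK mulmxA.
have tb0 : \forall z \near (0 : 'rV[R]_1), tdom t x by near=> z.
pose r := cayley t a.
pose gam w : tot (mxfam A n) := existT _ x (X *m (r w)%:M).
have g0 : gam 0 = p.
  rewrite /gam /r (cayley0 hA Bc Tt dx tx) mulmx1.
  by [].
have ncay := cayley_unitary hA hs mulC Bc Tt dx tx a_skew.
have nUg : \forall v \near (0 : 'rV[R]_1), unitary_group sigma J (gam v).
  by apply: filterS ncay => v rv; exact: unitary_scale.
have mC := max_atlas_sub sG (GL_atlas_in (A := A) n Bc Tt).
have sg : smooth_into c1 gam 0.
  apply: (smooth_into_subI sG Uc1 mC) => //; last by rewrite g0.
  apply/smooth_into_restrict; split; last by apply: filterS nUg => v [].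
  apply/smooth_into_mxP; split=> //=; first exact: (smooth_into_cst dx).
  apply: (smooth_mxM hA Tt Bc (smooth_into_cst dx 0) tb0).
    exact: smooth_mx_cst.
  apply: (smooth_mx_scalar hA Tt tb0); exact: (smooth_cayley hA Bc Tt dx tx).
pose yc v := cmap c1 (gam v).
have [dyc syc] := sg.
have yc0 : yc 0 = cmap c1 p by rewrite /yc g0.
have cyc : \forall v \near (0 : 'rV[R]_1), cinv c1 (yc v) = gam v.
  by apply: filterS dyc => v dv; have [_] := c1c; exact.
pose e := 'D_(const_mx 1) yc 0.
have dfu : differentiable u (yc 0) by rewrite yc0; exact: smooth_at_differentiable su.
have dfF : differentiable F (yc 0) by rewrite yc0; exact: smooth_at_differentiable sF.
have dfyc := smooth_at_differentiable syc.
exists e; rewrite -/u -yc0; split.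
  rewrite -(derive_compE _ dfyc dfu).
  rewrite (@near_eq_derive _ _ _ _ (cst (cmap c x))) ?derive_cst //.
  by apply: filterS cyc => v /= cv; rewrite /u cv.
rewrite -(derive_compE _ dfyc dfF).
pose g v := cayley_slope t a n v.
pose G v := mx_coord t ((g v - sigma (g v))%:M : 'M[A x]_1) *m Q.
have sgs : smooth_section t (beta := fun=> x) 0 g.
  exact: (smooth_cayley_slope hA Bc Tt dx tx).
have sG1 : smooth_at G 0.
  apply/smooth_at_mulmxr/smooth_mxE/(smooth_mx_scalar hA Tt tb0).
  apply: (smooth_sectionD hA Tt tb0) => //.
  apply: (smooth_sectionN hA Tt tb0).
  exact: (smooth_section_sigma hA Tt Bc (smooth_into_cst dx 0) tb0 hs).
rewrite (derive_scaled (G := G)).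
- have g0E : g 0 = ascale (2 * n%:R) (a 0 0).
    exact: (cayley_slope0 hA Bc Tt dx tx).
  have sa : sigma (a 0 0) = - a 0 0.
    have := congr1 (fun M : 'M[A x]_1 => M 0 0) a_skew.
    by rewrite [X in X = _]mxE [X in X = _]mxE [X in _ = X]mxE.
  rewrite /G; have -> : ((g 0 - sigma (g 0))%:M : 'M[A x]_1) = mxscale (4 * n%:R) a.
    apply/matrixP => i j; rewrite !ord1 [LHS]mxE [RHS]mxE mulr1n g0E (sigmaZ hs) sa.
    rewrite ascaleN opprK -ascaleDl; congr (ascale _ _); ring.
  rewrite /a mxscaleM divff ?mulf_neq0 ?pnatr_eq0 -?lt0n //.
  have -> : mxscale 1 (mx_of_coord x h) = mx_of_coord x h.
    by apply/matrixP => i j; rewrite [LHS]mxE ascale1.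
  by rewrite (mx_of_coordK hA Tt) // /h -mulmxA QQ mulmx1.
- exact: smooth_at_continuous.
- have npow := cayley_power hA Bc Tt dx tx a n.
  apply: filterS2 cyc npow => v /= cv pv.
  rewrite /F cv /Fd /G scalemxAl -(mx_coordZ hA Tt) //; congr (mx_coord t _ *m Q).
  have dg : tot_det (gam v) = 1 + ascale (v 0 0) (g v).
    rewrite /tot_det /= (det_mulmx_comm (@mulC x)) (det_scalar_comm (@mulC x)).
    by rewrite -[\det X]/(tot_det p) dp1 mul1r.
  rewrite /det_defect dg; apply/matrixP => i j.
  have E00 : ((g v - sigma (g v))%:M : 'M[A x]_1) 0 0 = g v - sigma (g v).
    by rewrite mxE.
  rewrite !ord1 [LHS]mxE [RHS]mxE E00 mulr1n.
  rewrite (sigmaD hs) (sigma1 hs) (sigmaZ hs) opprD addrACA subrr add0r.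
  by rewrite ascaleDr ascaleN.
Unshelve. all: end_near. Qed.

Lemma special_unitary_subfamily :
  is_subfamily (U_atlas B T sigma J) B (tot_proj (mxfam A n))
    (special_unitary_group sigma J).
Proof.
apply: regular_subfamily.
- apply: sub_atlas_smooth; exact: GL_atlas_smooth.
- exact: base_smooth hA.
- by have [_ _ [+ _]] := unitary_subfamily hA hs hJ hJnondeg.
- exact: special_unitary_closed.
- exact: special_unitary_regular.
Qed.

End SpecialUnitary.

Theorem mainTheorem19 (R : realType) (D : Type) (B : atlas R D)
    (A : D -> pzAlgType R) (T : set (triv R (fun x => A x)))
    (sigma : forall x, A x -> A x)
    (n : nat) (J : forall x, 'M[A x]_n)
    (hA : is_algebra_family B T)
    (hsigma : is_involution B T sigma)
    (hJ : smooth_map B (Herm_atlas B T sigma n)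
            (fun x => existT (mxfam A n) x (J x)))
    (hJnondeg : forall x, mx_invertible (J x)) :
  is_subfamily (GL_atlas B T n) B (tot_proj (mxfam A n))
    (unitary_group sigma J) /\
  ((forall x (a b : A x), a * b = b * a) ->
   is_subfamily (U_atlas B T sigma J) B (tot_proj (mxfam A n))
     (special_unitary_group sigma J)).
Proof.
split; first exact: (unitary_subfamily hA hsigma hJ hJnondeg).
by move=> mulC; exact: (special_unitary_subfamily hA hsigma hJ hJnondeg mulC).
Qed.
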